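(* Let $(\Gamma,\mu)$ be a stochastic dynamical system on $C([0,1])$ such that $$\mu^{\otimes\mathbb N}\Big(\Big\{(g_1,g_2,\ldots)\in\Gamma^{\mathbb N}:\ \sup_{n\ge 1}\bigvee_0^1 g_1g_2\cdots g_n<\infty\Big\}\Big)>0 .$$ Then the following statements hold: (i) If $\nu_1,\nu_2$ are ergodic $\mu$-invariant Borel probability measures that are concentrated on $(0,1)$ and that satisfy $\{0,1\}\cap\operatorname{supp}(\nu_1)\cap\operatorname{supp}(\nu_2)\neq\emptyset$, then $\nu_1=\nu_2$. (ii) If $(\Gamma,\mu)$ has no atomic $\mu$-invariant probability measure with finite support in the open interval $(0,1)$, then any two distinct $\mu$-invariant ergodic probability measures $\nu_1$ and $\nu_2$ on $(0,1)$ satisfy $\operatorname{supp}(\nu_1)\cap\operatorname{supp}(\nu_2)=\emptyset$.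
   Context: $C([0,1])$ denotes the space of all continuous functions $g:[0,1]\to[0,1]$ with the supremum metric. A stochastic dynamical system on $C([0,1])$ is a pair $(\Gamma,\mu)$ where $\mu$ is a Borel probability measure on $C([0,1])$ and $\Gamma=\operatorname{supp}(\mu)$ is its topological support. Products of functions denote composition: $g_1g_2\cdots g_n=g_1\circ g_2\circ\cdots\circ g_n$. $\bigvee_a^b g$ denotes the total variation of $g$ on $[a,b]$, i.e. the supremum of $\sum_{i=1}^n|g(x_i)-g(x_{i-1})|$ over all partitions $a=x_0<x_1<\cdots<x_n=b$ (possibly $+\infty$). A Borel probability measure $\nu$ on $[0,1]$ is $\mu$-invariant ($=\mu$-stationary) if $\nu(A)=\int_\Gamma \nu(g^{-1}(A))\,d\mu(g)$ for every Borel set $A\subset[0,1]$. A $\mu$-invariant probability measure is ($\mu$-)ergodic if it cannot be written as a proper convex combination of two different $\mu$-invariant Borel probability measures. A probability measure $\nu$ on $[0,1]$ is concentrated on (or is ''on'') $(0,1)$ if $\nu((0,1))=1$; $\operatorname{supp}(\nu)$ is the topological support of $\nu$ in $[0,1]$. *)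

(* Defs.v *)
From HB Require Import structures.
From mathcomp Require Import all_boot all_order all_algebra.
From mathcomp Require Import all_classical all_reals all_analysis.
From mathcomp Require Import giry.

Set Implicit Arguments.
Unset Strict Implicit.
Unset Printing Implicit Defensive.

Import Order.TTheory GRing.Theory Num.Theory.
Import numFieldNormedType.Exports.

Local Open Scope classical_set_scope.
Local Open Scope ring_scope.

Definition unitI (R : realType) : Type := set_type (`[0, 1]%classic : set R).

HB.instance Definition _ (R : realType) := PseudoMetric.copy (unitI R)
  (set_type (`[0, 1]%classic : set R)).

Lemma unitI_mem0 (R : realType) : (0 : R) \in (`[0, 1]%classic : set R).
Proof. by rewrite inE /= in_itv /= lexx ler01. Qed.

HB.instance Definition _ (R : realType) := isPointed.Build (unitI R)
  (exist _ 0 (unitI_mem0 R)).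

Definition uval (R : realType) (x : unitI R) : R := set_val x.

(* C([0,1]): continuous self-maps of [0,1] (not real-valued functions). *)
Definition cmap (R : realType) : Type := continuousType (unitI R) (unitI R).

Definition cmap_fun (R : realType) (g : cmap R) : unitI R -> unitI R :=
  Continuous.sort g.
Coercion cmap_fun : cmap >-> Funclass.

Definition cmap_arrow (R : realType) (g : cmap R) :
  arrow_uniform_type (unitI R) (unitI R) := g.

(* The pseudometric structure pulled back from arrow_uniform_type has as its
   e-balls the sets of h with |g x - h x| < e for all x; it induces the same
   topology as the supremum metric. *)
HB.instance Definition _ (R : realType) := Choice.copy (cmap R)
  (continuousType (unitI R) (unitI R)).
HB.instance Definition _ (R : realType) := PseudoMetric.copy (cmap R)
  (initial_topology (@cmap_arrow R)).
HB.instance Definition _ (R : realType) := isPointed.Build (cmap R)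
  ((@idfun (unitI R)) : continuousType (unitI R) (unitI R)).

Definition borel (T : ptopologicalType) := g_sigma_algebraType (@open T).

Definition supp (T : ptopologicalType) (R : realType)
    (m : probability (borel T) R) : set T :=
  [set x | forall U : set T, open U -> U x -> (0 < m U)%E].

Definition cylinders (T : ptopologicalType) : set (set (nat -> T)) :=
  [set A | exists (n : nat) (B : set (borel T)),
     measurable B /\ A = [set g | B (g n)]].

Definition seq_space (T : ptopologicalType) :=
  g_sigma_algebraType (@cylinders T).

(* P is the product measure of countably many copies of mu (it is uniquely
   determined on the product sigma-algebra by this property). *)
Definition is_infinite_product (T : ptopologicalType) (R : realType)
    (mu : probability (borel T) R) (P : probability (seq_space T) R) : Prop :=
  forall (n : nat) (A : nat -> set (borel T)),
    (forall i, measurable (A i)) ->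
    P [set g | forall i, (i < n)%N -> A i (g i)] =
    (\prod_(0 <= i < n) mu (A i))%E.

(* total_variation is defined for functions R -> R and only depends on their
   restriction to the interval, so f is extended by 0 outside [0,1]. *)
Definition tvar01 (R : realType) (f : unitI R -> unitI R) : \bar R :=
  total_variation 0 1
    (@valL_ R R 0 (`[0, 1]%classic : set R) (fun x => uval (f x))).

(* g_1 \o g_2 \o ... \o g_n, where g_i is g i.-1. *)
Fixpoint comp_prefix (R : realType) (g : nat -> cmap R) (n : nat) :
    unitI R -> unitI R :=
  if n is k.+1 then comp_prefix g k \o g k else idfun.

Definition bounded_variation_event (R : realType)
    (mu : probability (borel (cmap R)) R) : set (nat -> cmap R) :=
  [set g | (forall n, supp mu (g n)) /\
     (ereal_sup [set tvar01 (comp_prefix g n) | n in [set n | (0 < n)%N]]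
        < +oo)%E].

Definition mu_invariant (R : realType) (mu : probability (borel (cmap R)) R)
    (nu : probability (borel (unitI R)) R) : Prop :=
  forall A : set (borel (unitI R)), measurable A ->
    nu A = (\int[mu]_(g in supp mu)
              nu ((g : cmap R) @^-1` A))%E.

(* A measure is a function on all sets, only constrained on measurable ones;
   hence equality of measures is measure_eq rather than Leibniz equality. *)
Definition mu_ergodic (R : realType) (mu : probability (borel (cmap R)) R)
    (nu : probability (borel (unitI R)) R) : Prop :=
  mu_invariant mu nu /\
  ~ exists (nu1 nu2 : probability (borel (unitI R)) R) (t : R),
      [/\ mu_invariant mu nu1, mu_invariant mu nu2, ~ measure_eq nu1 nu2,
          0 < t < 1 &
          forall A : set (borel (unitI R)), measurable A ->
            nu A = (t%:E * nu1 A + (1 - t)%:E * nu2 A)%E].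

Definition open01 (R : realType) : set (unitI R) :=
  [set x | 0 < uval x < 1].

Definition end01 (R : realType) : set (unitI R) :=
  [set x | uval x = 0 \/ uval x = 1].

Definition concentrated (R : realType) (nu : probability (borel (unitI R)) R)
    (A : set (unitI R)) : Prop := nu A = 1%E.

Definition atomic (R : realType) (nu : probability (borel (unitI R)) R) :
    Prop :=
  exists2 D : set (unitI R), countable D & concentrated nu D.

(* Main.v *)
(* The proof compares the two ergodic measures along backward compositions
   h_n = g_1 ... g_n.

   If nu is ergodic and nu I > 0, the laws q_n of h_n x, with x distributed
   according to nu conditioned on I, average to nu: a Banach limit of the q_n is
   again a measure, as they are all dominated by a multiple of nu; it is
   invariant; and nu is a convex combination of this measure with the one
   obtained from the complement of I, so extremality applies.

   Suppose k disjoint intervals I_1, ..., I_k are each charged by nu1 and nu2.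
   If nu1 U > nu2 U for an open U, then averaging shows that, for some n, the
   expected number of intervals I_i on which h_n oscillates by at least r is at
   least c k, with c, r > 0 independent of k. But almost surely the number of
   disjoint intervals on which some h_n oscillates by at least r is bounded:
   this holds if the h_n have uniformly bounded variation; it survives the
   composition on the left with a continuous map, by uniform continuity; and by
   a zero-one law some shift of (g_i) almost surely lies in the bounded variation
   event. Dominated convergence as k grows gives a contradiction, so nu1 = nu2
   as soon as arbitrarily many such intervals exist.

   They exist near a common endpoint of the supports (no mass sits at the
   endpoint), and whenever K = supp nu1 & supp nu2 is infinite. If K is finite
   and nonempty, it is stable under the maps, and a Banach limit of the laws of
   h_n p, for p in K, is an invariant measure on K. *)
From HB Require Import structures.
Require Import Defs.
From mathcomp Require Import all_boot all_order all_algebra.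
From mathcomp Require Import all_classical all_reals all_analysis.
From mathcomp Require Import giry measurable_realfun.
From mathcomp Require Import ring lra.
Set Implicit Arguments.
Unset Strict Implicit.
Unset Printing Implicit Defensive.
Import Order.TTheory GRing.Theory Num.Theory.
Import numFieldNormedType.Exports.
Local Open Scope classical_set_scope.
Local Open Scope ring_scope.

(** * Image measures and the metric of the unit interval *)

(** The measurability proof is an argument so that the probability structure of the image measure
    can be inferred from the term itself. *)
Definition pushprob d1 d2 (T1 : measurableType d1) (T2 : measurableType d2)
    (R : realType) (m : probability T1 R) (f : T1 -> T2)
    (mf : measurable_fun setT f) : set T2 -> \bar R :=
  pushforward m f.

Section pushprob_probability.
Context d1 d2 (T1 : measurableType d1) (T2 : measurableType d2) (R : realType).
Variables (m : probability T1 R) (f : T1 -> T2) (mf : measurable_fun setT f).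

Let pushprob0 : pushprob m mf set0 = 0%E. Proof. exact: measure0. Qed.

Let pushprob_ge0 A : (0 <= pushprob m mf A)%E. Proof. exact: measure_ge0. Qed.

Let pushprob_sigma_additive : semi_sigma_additive (pushprob m mf).
Proof.
by move=> F *; apply: (@measure_semi_sigma_additive _ _ _ (@pushforward _ _ _ _ _ m f)).
Qed.

HB.instance Definition _ := isMeasure.Build _ _ _ (pushprob m mf)
  pushprob0 pushprob_ge0 pushprob_sigma_additive.

Let pushprobT : pushprob m mf setT = 1%E.
Proof. by rewrite /pushprob /pushforward preimage_setT probability_setT. Qed.

HB.instance Definition _ :=
  Measure_isProbability.Build _ _ _ (pushprob m mf) pushprobT.

End pushprob_probability.

Section sup_metric.
Variable R : realType.
Implicit Types x y : unitI R.

Lemma unitI_ballE x (e : R) y :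
  ball x e y = (`|uval x - uval y| < e) :> Prop.
Proof. by []. Qed.

Lemma uval_ge0 x : 0 <= uval x.
Proof. by have := set_valP x; rewrite /= in_itv /= => /andP[]. Qed.

Lemma uval_le1 x : uval x <= 1.
Proof. by have := set_valP x; rewrite /= in_itv /= => /andP[]. Qed.

Lemma uval_inj : injective (@uval R).
Proof. by move=> x y /val_inj. Qed.

Lemma clamp_subproof (t : R) :
  Num.max 0 (Num.min 1 t) \in (`[0, 1]%classic : set R).
Proof.
rewrite inE /= in_itv /= le_max lexx /= ge_max ler01 /=.
by rewrite ge_min lexx.
Qed.

(** The nearest-point retraction of the line onto the interval; it names points of [unitI R] by
    reals without carrying membership proofs. *)
Definition clamp (t : R) : unitI R :=
  exist (fun x : R => x \in (`[0, 1]%classic : set R)) _ (clamp_subproof t).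

Lemma clampE (t : R) : 0 <= t <= 1 -> uval (clamp t) = t.
Proof. by case/andP=> t0 t1; rewrite /uval/= set_valE /= (min_r t1) (max_r t0). Qed.

Lemma clamp_uval x : clamp (uval x) = x.
Proof. by apply: uval_inj; rewrite clampE // uval_ge0 uval_le1. Qed.

Lemma clamp_lipschitz (t s : R) :
  `|uval (clamp t) - uval (clamp s)| <= `|t - s|.
Proof.
rewrite /uval !set_valE /= ler_norml.
have [ts|ts] := leP 0 (t - s);
  rewrite ?(ger0_norm ts) ?(ltr0_norm ts); case: (leP 1 t) => t1; case: (leP 1 s) => s1;
  do 2?case: (leP 0) => ? //; apply/andP; split; lra.
Qed.

Lemma clamp_continuous : continuous clamp.
Proof.
move=> t; apply/cvg_ballP => e e0; near=> s.
have ts : `|t - s| < e by near: s; apply: cvgr_dist_lt => //; exact: cvg_id.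
apply: le_lt_trans ts.
exact: clamp_lipschitz.
Unshelve. all: by end_near. Qed.

End sup_metric.

(** * Joint measurability of evaluation *)

Lemma borel_measurable_fun d (X : measurableType d) (T : ptopologicalType)
    (f : X -> borel T) :
  (forall U : set T, open U -> measurable (f @^-1` U)) -> measurable_fun setT f.
Proof.
move=> fU; apply: (@measurability _ _ _ _ setT f (@open T)) => //.
by move=> _ [U oU <-]; rewrite setTI; exact: fU.
Qed.

Lemma open_measurable_borel (T : ptopologicalType) (U : set T) :
  open U -> measurable (U : set (borel T)).
Proof. by move=> oU; exact: sub_gen_smallest. Qed.

Section evaluation.
Variable R : realType.
Implicit Types (x y : unitI R) (f g : cmap R).

(** For [j <= m.+1] these are the endpoints of the division of the interval into [m.+1] equal cells;
    clamping gives a meaning to larger [j]. *)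
Definition grid (m j : nat) : unitI R := clamp (j%:R / m.+1%:R).

Lemma grid_approx (m : nat) x :
  `|uval (grid m (Num.truncn (uval x * m.+1%:R))) - uval x| < m.+1%:R^-1.
Proof.
have m0 : 0 < m.+1%:R :> R by [].
have xm : 0 <= uval x * m.+1%:R by rewrite mulr_ge0 ?uval_ge0.
have /andP[l u] := truncn_itv xm.
set j := Num.truncn _ in l u *.
have jx : j%:R / m.+1%:R <= uval x by rewrite ler_pdivrMr.
rewrite clampE; last by rewrite divr_ge0//= (le_trans jx)// uval_le1.
rewrite ler0_norm ?subr_le0// opprB ltrBlDr.
by rewrite -[X in X + _]mul1r -mulrDl ltr_pdivlMr// nat1r.
Qed.

Lemma cmap_cvg f x (e : R) : 0 < e ->
  exists2 d : R, 0 < d & forall y, `|uval x - uval y| < d ->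
    `|uval (f x) - uval (f y)| < e.
Proof.
move=> e0; have /cvg_ballP/(_ e e0) := @cts_fun _ _ f x.
by move=> /nbhs_ballP[d d0 fd]; exists d.
Qed.

Lemma unitI_ball_open x (e : R) : open (ball x e).
Proof.
rewrite openE => y; rewrite unitI_ballE => xy.
apply/nbhs_ballP; exists (e - `|uval x - uval y|); first by rewrite /= subr_gt0.
move=> z; rewrite !unitI_ballE => yz.
by rewrite (le_lt_trans (ler_distD (uval y) _ _))// -ltrBrDl.
Qed.

(** The product carries the product sigma-algebra, so joint continuity is not enough as such. The
    preimage of an open [U] is written as a countable union of rectangles: an open set of maps
    sending a grid ball into [U] with a margin [r], times that ball. The margin makes the set of
    maps open. *)
Lemma measurable_eval :
  measurable_fun setT (fun p : borel (cmap R) * borel (unitI R) =>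
    (p.1 : cmap R) p.2 : borel (unitI R)).
Proof.
apply: borel_measurable_fun => U oU.
pose E m j : set (cmap R) := [set g | exists2 r : R, 0 < r &
  forall y, ball (grid m j) m.+1%:R^-1 y -> ball (g y) r `<=` U].
have oE m j : open (E m j).
  rewrite openE => g [r r0 gr]; apply/nbhs_ballP; exists (r / 2) => [|h gh].
    by rewrite /= divr_gt0.
  exists (r / 2) => [|y /gr gU z hz]; first by rewrite divr_gt0.
  by apply: gU; apply: ball_split (hz); exact: gh.
rewrite [X in measurable X](_ : _ = \bigcup_m \bigcup_j
    (E m j `*` ball (grid m j) m.+1%:R^-1)).
  apply: bigcup_measurable => m _; apply: bigcup_measurable => j _.
  by apply: measurableX; apply: open_measurable_borel => //; exact: unitI_ball_open.
apply/seteqP; split => [[g x] /= Ugx|[g x] [m _ [j _ [[r r0 Er] bx]]]]; last first.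
  by apply: (Er x) => //; exact: ballxx.
have /nbhs_ballP[r /= r0 rU] : nbhs (g x) U by exact: open_nbhs_nbhs.
have [|d d0 gd] := @cmap_cvg g x (r / 2); first by rewrite divr_gt0.
(* Any point of the grid ball is then within [d / 2 + d / 2] of [x]. *)
have [m md] : exists m : nat, m.+1%:R^-1 < d / 2.
  have [m _ md] := near_infty_natSinv_lt (PosNum (divr_gt0 d0 (ltr0Sn R 1))).
  by exists m; exact: (md m (leqnn m)).
exists m => //; exists (Num.truncn (uval x * m.+1%:R)) => //.
split; last exact: grid_approx.
exists (r / 2) => [|y /= gy z gz]; first by rewrite divr_gt0.
apply: rU; apply: ball_split gz; apply: gd.
have -> : uval x - uval y = (uval x - uval (grid m (Num.truncn (uval x * m.+1%:R))))
  + (uval (grid m (Num.truncn (uval x * m.+1%:R))) - uval y) by rewrite addrA subrK.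
rewrite [d]splitr (le_lt_trans (ler_normD _ _))// ltrD// (lt_trans _ md)//.
by rewrite distrC grid_approx.
Qed.

End evaluation.

(** * Sequence spaces and infinite products *)

Definition rectangle (T : ptopologicalType) (n : nat)
    (A : nat -> set (borel T)) : set (seq_space T) :=
  [set w | forall i, (i < n)%N -> A i (w i)].

Definition rectangles (T : ptopologicalType) : set (set (seq_space T)) :=
  [set X | exists n A, (forall i, measurable (A i)) /\ X = @rectangle T n A].

Definition seq_cons (T : Type) (g : T) (w : nat -> T) : nat -> T :=
  fun n => if n is k.+1 then w k else g.

Definition shift (T : Type) (w : nat -> T) : nat -> T := fun n => w n.+1.

Section sequence_space.
Variable T : ptopologicalType.

Lemma measurable_coord (n : nat) :
  measurable_fun setT (fun w : seq_space T => w n : borel T).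
Proof.
move=> _ B mB; rewrite setTI; apply: sub_gen_smallest.
by exists n, B.
Qed.

Lemma measurable_fun_seq_space d (X : measurableType d) (f : X -> seq_space T) :
  (forall n, measurable_fun setT (fun x => f x n : borel T)) ->
  measurable_fun setT f.
Proof.
move=> mf; apply: (@measurability _ _ _ _ setT f (@cylinders T)) => //.
by move=> _ [_ [n [B [mB ->]]] <-]; exact: mf.
Qed.

Lemma measurable_shift : measurable_fun setT (@shift T : seq_space T -> seq_space T).
Proof. by apply: measurable_fun_seq_space => n; exact: measurable_coord. Qed.

Lemma measurable_seq_cons : measurable_fun setT
  (fun p : borel T * seq_space T => seq_cons p.1 p.2 : seq_space T).
Proof.
apply: measurable_fun_seq_space => -[|n] /=; first exact: measurable_fst.
exact: (measurableT_comp (measurable_coord n) measurable_snd).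
Qed.

Lemma measurable_rectangle n (A : nat -> set (borel T)) :
  (forall i, measurable (A i)) -> measurable (rectangle n A).
Proof.
move=> mA; rewrite [X in measurable X](_ : _ =
    \bigcap_(i in `I_n) ((fun w : seq_space T => w i : borel T) @^-1` A i)) //.
apply: bigcap_measurableType => i _.
by rewrite -[X in measurable X]setTI; exact: measurable_coord.
Qed.

Lemma rectangles_setI_closed : setI_closed (@rectangles T).
Proof.
move=> _ _ [n [A [mA ->]]] [m [B [mB ->]]].
exists (maxn n m), (fun i => (if (i < n)%N then A i else setT) `&`
                             (if (i < m)%N then B i else setT)); split.
  by move=> i; apply: measurableI; case: ifP.
apply/seteqP; split=> w /=.
  by move=> [wA wB] i _; split; case: ifPn => // ?; [exact: wA|exact: wB].
move=> wAB; split => i im.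
  by have := wAB i; rewrite leq_max im => /(_ isT)[].
by have := wAB i; rewrite leq_max im orbT => /(_ isT)[].
Qed.

Lemma seq_space_measurableE :
  @measurable _ (seq_space T) = <<s @rectangles T >>.
Proof.
apply/seteqP; split; apply: smallest_sub; try exact: smallest_sigma_algebra.
  move=> _ [n [B [mB ->]]]; apply: sub_gen_smallest.
  exists n.+1, (fun i => if i == n then B else setT); split.
    by move=> i; case: ifP.
  apply/seteqP; split=> w /= wB; last by have := wB n (ltnSn n); rewrite eqxx.
  by move=> i _; case: eqP => // ->.
by move=> _ [n [A [mA ->]]]; exact: measurable_rectangle.
Qed.

(** Rectangles are stable under intersection, generate the sigma-algebra and include the whole
    space, as the rectangle of length 0. *)
Lemma seq_space_measure_unique (R : realType)
    (m1 m2 : {measure set (seq_space T) -> \bar R}) :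
  (m1 setT < +oo)%E ->
  (forall n (A : nat -> set (borel T)), (forall i, measurable (A i)) ->
     m1 (rectangle n A) = m2 (rectangle n A)) ->
  forall A : set (seq_space T), measurable A -> m1 A = m2 A.
Proof.
move=> m1T m12; apply: (measure_unique (@rectangles T) (fun=> setT)).
- exact: seq_space_measurableE.
- exact: rectangles_setI_closed.
- move=> _; exists 0%N, (fun=> setT); split => //.
  by apply/seteqP; split.
- by rewrite bigcup_const//; exists 0%N.
- by move=> _ [n [A [mA ->]]]; exact: m12.
- by [].
Qed.

End sequence_space.

(** * Backward compositions: measurability, recursion, continuity *)

Section composition_prefix.
Variable R : realType.

Lemma measurable_comp_prefix n : measurable_fun setT
  (fun p : seq_space (cmap R) * borel (unitI R) =>
     comp_prefix p.1 n p.2 : borel (unitI R)).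
Proof.
elim: n => [|n IH] /=; first exact: measurable_snd.
pose G (p : seq_space (cmap R) * borel (unitI R)) :
  seq_space (cmap R) * borel (unitI R) := (p.1, (p.1 n : cmap R) p.2).
apply: (measurableT_comp IH (g := G)).
apply: measurable_fun_pair; first exact: measurable_fst.
apply: (measurableT_comp (@measurable_eval R)
  (g := fun p : seq_space (cmap R) * borel (unitI R) =>
          ((p.1 n, p.2) : borel (cmap R) * borel (unitI R)))).
apply: measurable_fun_pair; last exact: measurable_snd.
exact: (measurableT_comp (@measurable_coord (cmap R) n) measurable_fst).
Qed.

(** The recursive definition adds maps on the inside; peeling off the outermost map instead is what
    links the compositions to the shift. *)
Lemma comp_prefixS (w : nat -> cmap R) n x :
  comp_prefix w n.+1 x = w 0%N (comp_prefix (shift w) n x).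
Proof. by elim: n x => //= n IH x; rewrite -IH. Qed.

Lemma comp_prefix_continuous (w : nat -> cmap R) n :
  continuous (comp_prefix w n).
Proof.
elim: n => [|n IH] x /=; first exact: cvg_id.
by apply: continuous_comp; [exact: cts_fun|exact: IH].
Qed.

End composition_prefix.

(** * Prepending, shifting and independence under the product measure *)

Section infinite_product.
Variables (T : ptopologicalType) (R : realType).
Variables (mu : probability (borel T) R) (P : probability (seq_space T) R).
Hypothesis hP : is_infinite_product mu P.
Local Open Scope ereal_scope.

Lemma product_rectangle n (A : nat -> set (borel T)) :
  (forall i, measurable (A i)) ->
  P (rectangle n A) = \prod_(0 <= i < n) mu (A i).
Proof. exact: hP. Qed.

(** An i.i.d. sequence keeps its law when an independent sample of [mu] is prepended: both laws give
    the same values on rectangles. *)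
Lemma product_cons (A : set (seq_space T)) : measurable A ->
  P A = (mu \x P) ((fun p => seq_cons p.1 p.2) @^-1` A).
Proof.
pose Q := pushprob (mu \x P)%E (@measurable_seq_cons T).
move: A; apply: (seq_space_measure_unique (m1 := P) (m2 := Q)).
  by rewrite [ltLHS](probability_setT P) ltry.
move=> [|n] A mA.
  rewrite (_ : rectangle 0 A = setT); last by apply/seteqP; split.
  by transitivity (1 : \bar R); [exact: probability_setT|exact/esym/probability_setT].
rewrite [LHS]product_rectangle// big_nat_recl//.
rewrite [RHS](_ : _ =
  (mu \x P) (A 0%N `*` rectangle n (fun i => A i.+1))); last first.
  congr ((mu \x P) _).
  apply/seteqP; split=> [[g w] /= gw|[g w] /= [Ag Aw] [|i] //]; last first.
    exact: Aw.
  by split; [exact: (gw 0%N)|move=> i im; exact: (gw i.+1)].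
rewrite product_measure1E//; last by apply: measurable_rectangle => i.
by congr (_ * _); rewrite -product_rectangle.
Qed.

Lemma product_shift (A : set (seq_space T)) : measurable A ->
  P (@shift T @^-1` A) = P A.
Proof.
move=> mA; rewrite product_cons; last first.
  by rewrite -[X in measurable X]setTI; exact: measurable_shift.
rewrite (_ : _ @^-1` _ = setT `*` A); last first.
  by apply/seteqP; split=> [[g w]|[g w] []].
by rewrite product_measure1E// [X in X * _](probability_setT mu) mul1e.
Qed.

(** Independence of the first [n] coordinates from the sequence that follows them, by splitting off
    one coordinate at a time with [product_cons]. *)
Lemma product_rectangle_shift n (A : nat -> set (borel T)) (B : set (seq_space T)) :
  (forall i, measurable (A i)) -> measurable B ->
  P (rectangle n A `&` iter n (preimage (@shift T)) B) = P (rectangle n A) * P B.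
Proof.
move=> mA mB; have mshift k : measurable (iter k (preimage (@shift T)) B : set (seq_space T)).
  elim: k => //= k IH.
  by rewrite -[X in measurable X]setTI; exact: measurable_shift.
elim: n A mA => [|n IH] A mA.
  rewrite (_ : rectangle 0 A = setT); last by apply/seteqP; split.
  by rewrite setTI [X in X * _](probability_setT P) mul1e.
rewrite product_cons; last first.
  by apply: measurableI => //; exact: measurable_rectangle.
rewrite (_ : _ @^-1` _ = A 0%N `*`
  (rectangle n (fun i => A i.+1) `&` iter n (preimage (@shift T)) B)); last first.
  apply/seteqP; split=> [[g w] /= [gw Bw]|[g w] /= [Ag [Aw Bw]]].
    by split; [exact: (gw 0%N)|split => // i im; exact: (gw i.+1)].
  by split => // -[|i] //; exact: Aw.
rewrite product_measure1E//; last first.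
  by apply: measurableI => //; exact: measurable_rectangle.
by rewrite [X in _ * X]IH// [X in _ * (X * _)]product_rectangle//
  [X in _ = X * _]product_rectangle// big_nat_recl// muleA.
Qed.

End infinite_product.

(** * Total variation through uniform grids *)

Lemma cvg_sumr (R : realType) (I : Type) (r : seq I) (u : I -> nat -> R)
    (l : I -> R) :
  (forall i, u i n @[n --> \oo] --> l i) ->
  (\sum_(i <- r) u i n) @[n --> \oo] --> \sum_(i <- r) l i.
Proof.
move=> ul; elim: r => [|i r IH].
  by under eq_fun do rewrite big_nil; rewrite big_nil; exact: cvg_cst.
by under eq_fun do rewrite big_cons; rewrite big_cons; exact: cvgD.
Qed.

Section variation.
Variable R : realType.
Implicit Types (x y : unitI R) (f : unitI R -> unitI R) (M : R).

(** For continuous [f], the supremum over [m] is the total variation ([tvar01_le],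
    [grid_variation_le_tvar01]); this replaces all partitions by countably many finite sums. *)
Definition grid_variation f (m : nat) : R :=
  \sum_(0 <= j < m.+1) `|uval (f (grid R m j.+1)) - uval (f (grid R m j))|.

Definition floor_idx (m : nat) x : nat := Num.truncn (uval x * m.+1%:R).

Lemma floor_idx_itv m x :
  (floor_idx m x)%:R <= uval x * m.+1%:R < (floor_idx m x).+1%:R.
Proof. by apply: truncn_itv; rewrite mulr_ge0 ?uval_ge0. Qed.

Lemma floor_idx_le m x : (floor_idx m x <= m.+1)%N.
Proof.
have /andP[+ _] := floor_idx_itv m x; rewrite -(ler_nat R) => /le_trans; apply.
by rewrite ler_piMl// uval_le1.
Qed.

Lemma floor_idx_homo m x y : uval x <= uval y -> (floor_idx m x <= floor_idx m y)%N.
Proof.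
move=> xy; have /andP[lx _] := floor_idx_itv m x.
have /andP[_ uy] := floor_idx_itv m y.
rewrite -ltnS -(ltr_nat R); apply: le_lt_trans lx (le_lt_trans _ uy).
by rewrite ler_pM2r.
Qed.

Lemma uval_continuous : continuous (@uval R).
Proof. exact: initial_continuous. Qed.

Lemma grid_floor_cvg f x : continuous f ->
  uval (f (grid R m (floor_idx m x))) @[m --> \oo] --> uval (f x).
Proof.
move=> cf; apply: continuous_cvg; first exact: uval_continuous.
apply: continuous_cvg; first exact: cf.
apply/cvg_ballP => e e0; have := near_infty_natSinv_lt (PosNum e0).
apply: filterS => m /=; rewrite unitI_ballE distrC; apply: lt_trans.
exact: grid_approx.
Qed.

Lemma sum_grid_le f m (k l : nat) : (k <= l <= m.+1)%N ->
  `|uval (f (grid R m l)) - uval (f (grid R m k))| <=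
  \sum_(j < m.+1 | (k <= j < l)%N)
    `|uval (f (grid R m j.+1)) - uval (f (grid R m j))|.
Proof.
move=> /andP[kl lm].
rewrite -(telescope_sumr (fun j => uval (f (grid R m j))) kl).
apply: (le_trans (ler_norm_sum _ _ _)).
rewrite (big_nat_widenl _ 0%N)//= (big_nat_widen _ _ m.+1)//= big_mkord.
by under eq_bigl do rewrite andbC.
Qed.

(* The grid points in ]x i, y i] distinguish the intervals, so every grid cell
   is counted for at most one i. *)
Lemma sum_increments_le f M (I : finType) (x y : I -> unitI R) :
  continuous f -> (forall m, grid_variation f m <= M) ->
  (forall i, uval (x i) <= uval (y i)) ->
  (forall i j (t : R), uval (x i) < t <= uval (y i) ->
    uval (x j) < t <= uval (y j) -> i = j) ->
  \sum_i `|uval (f (y i)) - uval (f (x i))| <= M.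
Proof.
move=> cf fM xy dis.
pose u i m := `|uval (f (grid R m (floor_idx m (y i)))) -
                uval (f (grid R m (floor_idx m (x i))))|.
(* By continuity the increments are limits of increments between grid points, so it is enough to
   bound the latter for each [m]. *)
have ucvg : (\sum_(i <- index_enum I) u i m) @[m --> \oo] -->
    \sum_(i <- index_enum I) `|uval (f (y i)) - uval (f (x i))|.
  apply: cvg_sumr => i; apply: cvg_norm; apply: cvgB; exact: grid_floor_cvg.
rewrite -(cvg_lim _ ucvg)//; apply: limr_le; first by apply/cvg_ex; eexists; exact: ucvg.
apply: nearW => m; apply: le_trans (fM m).
rewrite /grid_variation big_mkord.
apply: (@le_trans _ _ (\sum_i \sum_(j < m.+1 |
    (floor_idx m (x i) <= j < floor_idx m (y i))%N)
    `|uval (f (grid R m j.+1)) - uval (f (grid R m j))|)).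
  apply: ler_sum => i _; apply: sum_grid_le.
  by rewrite floor_idx_homo//= floor_idx_le.
rewrite (exchange_big_dep predT)//=; apply: ler_sum => j _.
rewrite big_const iter_addr_0 -[leRHS]mulr1n ler_wpMn2l//.
apply/card_le1_eqP => i i'. rewrite !unfold_in.
have inside k : (floor_idx m (x k) <= j < floor_idx m (y k))%N ->
    uval (x k) < j.+1%:R / m.+1%:R <= uval (y k).
  move=> /andP[xj jy]; rewrite ltr_pdivlMr// ler_pdivrMr//.
  have /andP[_ ux] := floor_idx_itv m (x k).
  have /andP[ly _] := floor_idx_itv m (y k).
  apply/andP; split; first by apply: lt_le_trans ux _; rewrite ler_nat.
  by apply: le_trans ly; rewrite ler_nat.
by move=> /inside ji' /inside ji; exact: dis ji ji'.
Qed.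

End variation.

Section total_variation.
Variable R : realType.
Implicit Types (x y : unitI R) (f : unitI R -> unitI R) (M : R).

Let extend f : R -> R :=
  @valL_ R R 0 (`[0, 1]%classic : set R) (fun x => uval (f x)).

Let extendE f x : extend f (uval x) = uval (f x).
Proof.
by have /(congr1 (fun h => h x)) :=
  @valLK R R 0 (`[0, 1]%classic : set R) (fun x => uval (f x)).
Qed.

(** The half-open intervals between consecutive points of a partition are disjoint, so
    [sum_increments_le] bounds every variation sum. *)
Lemma tvar01_le f M : continuous f -> (forall m, grid_variation f m <= M) ->
  (tvar01 f <= M%:E)%E.
Proof.
move=> cf fM; apply: ub_ereal_sup => _ [_ [s s01 <-] <-].
rewrite lee_fin /variation.
pose t (n : nat) : R := nth 1 (0 :: s) n.
have t01 n : (n < (size s).+1)%N -> 0 <= t n <= 1.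
  by move=> ns; rewrite itv_partition_nth_ge ?itv_partition_nth_le.
have tS i j : (i <= j)%N -> (j < (size s).+1)%N -> t i <= t j.
  move=> ij js; have [s1 _] := s01.
  apply: (@sorted_leq_nth _ <=%R (@le_trans _ _) lexx 1 (0 :: s)) => //=.
    by apply: (sub_path _ s1) => a b /ltW.
  exact: leq_ltn_trans ij js.
rewrite big_mkord; pose x (i : 'I_(size s)) := clamp (t i).
pose y (i : 'I_(size s)) := clamp (t i.+1).
have xE i : uval (x i) = t i.
  by rewrite clampE//; apply: t01; exact: (ltnW (ltn_ord i)).
have yE i : uval (y i) = t i.+1.
  by rewrite clampE//; apply: t01; exact: (ltn_ord i).
rewrite (eq_bigr (fun i => `|uval (f (y i)) - uval (f (x i))|)); last first.
  by move=> i _; rewrite -!extendE xE yE.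
apply: (sum_increments_le cf fM) => [i|i j u].
  by rewrite xE yE; apply: tS => //; exact: (ltn_ord i).
rewrite !xE !yE => /andP[iu ui] /andP[ju uj].
case: (ltngtP i j) => [ij|ij|/val_inj//].
  have := lt_le_trans ju (le_trans ui (tS _ _ ij _)).
  by rewrite ltxx => /(_ (ltnW (ltn_ord j))).
have := lt_le_trans iu (le_trans uj (tS _ _ ij _)).
by rewrite ltxx => /(_ (ltnW (ltn_ord i))).
Qed.

Lemma grid_variation_le_tvar01 f m : ((grid_variation f m)%:E <= tvar01 f)%E.
Proof.
(* Partitions are listed without their left endpoint, hence the start at the grid point of index
   1. *)
pose s := [seq j.+1%:R / m.+1%:R | j <- iota 0 m.+1] : seq R.
have gridE j : (j <= m.+1)%N -> uval (grid R m j) = j%:R / m.+1%:R.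
  move=> jm; rewrite clampE// divr_ge0//= ler_pdivrMr// mul1r ler_nat//.
have sE j : (j <= m.+1)%N -> nth 1 (0 :: s) j = uval (grid R m j).
  move=> jm; rewrite gridE//; case: j jm => [|j] jm; first by rewrite mul0r.
  by rewrite /= (nth_map 0%N) ?size_iota// nth_iota.
apply: ereal_sup_ubound; exists (grid_variation f m) => //; exists s.
  split; last first.
    by rewrite (last_nth 1) size_map size_iota sE// gridE// divff.
  apply/(pathP 1) => i; rewrite size_map size_iota => im.
  rewrite sE ?(ltnW im)// [X in _ < X](sE i.+1 im) !gridE ?(ltnW im)//.
  by rewrite ltr_pM2r ?invr_gt0// ltr_nat.
rewrite /variation /grid_variation size_map size_iota !big_mkord.
apply: eq_bigr => i _.
rewrite -2!extendE -(sE i.+1 (ltn_ord i)) -(sE i (ltnW (ltn_ord i))).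
by [].
Qed.

End total_variation.

(** * The bounded variation event and the zero-one law *)

Lemma open_setC_supp (T : ptopologicalType) (R : realType)
    (m : probability (borel T) R) : open (~` supp m).
Proof.
rewrite openE => x /= /existsNP[U /not_implyP[oU /not_implyP[Ux mU]]].
rewrite /interior nbhsE; exists U => // y Uy /(_ U oU Uy).
exact: mU.
Qed.

Lemma measurable_supp (T : ptopologicalType) (R : realType)
    (m : probability (borel T) R) : measurable (supp m : set (borel T)).
Proof.
rewrite -[supp m]setCK; apply: measurableC; apply: open_measurable_borel.
exact: open_setC_supp.
Qed.

Section bounded_variation_event.
Variable R : realType.
Variables (mu : probability (borel (cmap R)) R).
Variables (P : probability (seq_space (cmap R)) R).
Hypothesis hP : is_infinite_product mu P.
Hypothesis hbv : (0 < P (bounded_variation_event mu))%E.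

Let G : set (seq_space (cmap R)) := bounded_variation_event mu.

(** This form involves only countably many conditions on finite sums, from which measurability
    follows. *)
Lemma bounded_variation_eventE : bounded_variation_event mu =
  [set w | forall n, supp mu (w n)] `&`
  \bigcup_M [set w | forall n m, grid_variation (comp_prefix w n.+1) m <= M%:R].
Proof.
apply/seteqP; split => [w [ws tv]|w [ws [M _ wM]]]; split=> //.
  have tv0 : (0 <= ereal_sup [set tvar01 (comp_prefix w n) | n in [set n | (0 < n)%N]])%E.
    apply: le_trans (ereal_sup_ubound _); last by exists 1%N.
    exact: total_variation_ge0.
  exists (Num.truncn (fine (ereal_sup
    [set tvar01 (comp_prefix w n) | n in [set n | (0 < n)%N]]))).+1 => // n m.
  rewrite -lee_fin; apply: le_trans (grid_variation_le_tvar01 _ _) _.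
  apply: (@le_trans _ _ (ereal_sup
    [set tvar01 (comp_prefix w n) | n in [set n | (0 < n)%N]])).
    by apply: ereal_sup_ubound; exists n.+1.
  rewrite -[leLHS]fineK ?ge0_fin_numE// lee_fin.
  by have /andP[_ /ltW] := truncn_itv (fine_ge0 tv0).
apply: le_lt_trans (ltry M%:R); apply: ub_ereal_sup => _ [[|n]// _ <-].
by apply: tvar01_le => [|m]; [exact: comp_prefix_continuous|exact: wM].
Qed.

Lemma measurable_uval : measurable_fun setT (@uval R : borel (unitI R) -> R).
Proof.
apply: (measurability _ (measurable_realfun.RGenOInfty.measurableE R)).
move=> _ [_ [t ->] <-]; rewrite setTI; apply: open_measurable_borel.
by apply: open_comp => [x _|]; [exact: uval_continuous|exact: interval_open].
Qed.

Lemma measurable_uval_comp_prefix n (x : unitI R) : measurable_fun setT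
  (fun w : seq_space (cmap R) => uval (comp_prefix w n x)).
Proof.
apply: (measurableT_comp measurable_uval
  (g := fun w : seq_space (cmap R) => comp_prefix w n x : borel (unitI R))).
apply: (measurableT_comp (@measurable_comp_prefix R n)
  (g := fun w => ((w, x) : seq_space (cmap R) * borel (unitI R)))).
by apply: measurable_fun_pair => //; exact: measurable_id.
Qed.

Lemma measurable_bounded_variation_event : measurable G.
Proof.
rewrite /G bounded_variation_eventE; apply: measurableI.
  rewrite [X in measurable X](_ : _ = \bigcap_n
    ((fun w : seq_space (cmap R) => w n : borel (cmap R)) @^-1` supp mu)); last first.
    by apply/seteqP; split => [w ws n _|w ws n]; [exact: ws|exact: (ws n)].
  apply: bigcap_measurableType => n _; rewrite -[X in measurable X]setTI.
  by apply: measurable_coord => //; exact: measurable_supp.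
apply: bigcup_measurable => M _.
rewrite [X in measurable X](_ : _ = \bigcap_n \bigcap_m
  (setT `&` [set w : seq_space (cmap R) |
    grid_variation (comp_prefix w n.+1) m <= (fun=> M%:R) w])); last first.
  apply/seteqP; split => [w wM n _ m _|w wM n m]; first by split => //; exact: wM.
  by have [] := wM n I m I.
apply: bigcap_measurableType => n _; apply: bigcap_measurableType => m _.
apply: measurable_fun_le => //; apply: measurable_sum => j.
apply: measurableT_comp => //; apply: measurable_funB;
  exact: measurable_uval_comp_prefix.
Qed.

(** The bounded variation event forces every coordinate into the support, so its probability is at
    most [p ^+ n] for all [n], where [p] is the mass of the support; [p < 1] would make it null. *)
Lemma supp_full : mu (supp mu) = 1%E.
Proof.
have mS := measurable_supp mu.
have [p Sp] : exists p : R, mu (supp mu) = p%:E.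
  by exists (fine (mu (supp mu))); rewrite fineK ?fin_num_measure.
have p1 : p <= 1 by rewrite -lee_fin -Sp probability_le1.
have p0 : 0 <= p by rewrite -lee_fin -Sp.
rewrite Sp; congr (_%:E); apply/eqP; rewrite eq_le p1/= leNgt; apply/negP => lt1.
have PG n : (P G <= (p ^+ n)%:E)%E.
  apply: (@le_trans _ _ (P (rectangle n (fun=> supp mu : set (borel (cmap R)))))).
    apply: le_measure; rewrite ?inE; [exact: measurable_bounded_variation_event| |].
      by apply: measurable_rectangle.
    by move=> w [ws _] i _; exact: ws.
  rewrite (product_rectangle hP)// Sp big_const_nat subn0 /=.
  by elim: n => //= n IH; rewrite exprS EFinM lee_wpmul2l// lee_fin.
have := hbv; rewrite ltNge => /negP; apply.
have [q Gq] : exists q : R, P G = q%:E.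
  exists (fine (P G)); rewrite fineK// fin_num_measure//.
  exact: measurable_bounded_variation_event.
rewrite Gq lee_fin.
have cv : (p ^+ n) @[n --> \oo] --> (0 : R) by apply: cvg_expr; rewrite ger0_norm.
rewrite -(cvg_lim _ cv)//; apply: limr_ge; first by apply/cvg_ex; eexists; exact: cv.
by apply: nearW => n; rewrite -lee_fin -Gq.
Qed.

Definition eventually_bv : set (seq_space (cmap R)) :=
  \bigcup_j iter j (preimage (@shift (cmap R))) G.

Lemma measurable_eventually_bv : measurable eventually_bv.
Proof.
apply: bigcup_measurable => j _; elim: j => /= [|j IH].
  exact: measurable_bounded_variation_event.
by rewrite -[X in measurable X]setTI; exact: measurable_shift.
Qed.

(* N is contained in its preimage under the shift, which has the same measure;
   so N agrees up to null sets with an event independent of the first n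
   coordinates, for every n. *)
Lemma eventually_bv_full : P (~` eventually_bv) = 0%E.
Proof.
set N := ~` eventually_bv; have mN : measurable N.
  by apply: measurableC; exact: measurable_eventually_bv.
have mNn n : measurable (iter n (preimage (@shift (cmap R))) N : set (seq_space (cmap R))).
  elim: n => //= n IH.
  by rewrite -[X in measurable X]setTI; exact: measurable_shift.
have NS : N `<=` @shift (cmap R) @^-1` N.
  by move=> w Nw [j _ wj]; apply: Nw; exists j.+1.
have NSn n : N `<=` iter n (preimage (@shift (cmap R))) N.
  by elim: n => //= n IH w /NS; exact: IH.
have PNn n : P (iter n (preimage (@shift (cmap R))) N) = P N.
  by elim: n => //= n IH; rewrite (product_shift hP).
have Nnull n : P (iter n (preimage (@shift (cmap R))) N `\` N) = 0%E.
  rewrite measureD//; last by rewrite ltey_eq fin_num_measure.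
  by rewrite setIidr// [X in (X - _)%E]PNn subee// fin_num_measure.
(* [N] is independent of every event: on a rectangle of length [n], it may be replaced by its
   preimage under [n] shifts, which depends only on later coordinates. *)
have indep (A : set (seq_space (cmap R))) : measurable A ->
    mrestr P mN A = mscale (NngNum (fine_ge0 (measure_ge0 P N))) P A.
  apply: seq_space_measure_unique => [|n B mB].
    by rewrite [ltLHS](congr1 P (setTI N)) ltey_eq fin_num_measure.
  have mrB := measurable_rectangle n mB.
  transitivity (P (rectangle n B `&` N)) => //.
  transitivity ((fine (P N))%:E * P (rectangle n B))%E => //.
  rewrite fineK ?fin_num_measure// muleC.
  rewrite -(product_rectangle_shift hP)//; apply/eqP; rewrite eq_le.
  rewrite le_measure ?inE//=; [|exact: measurableI..|exact: setIS].
  apply: (@le_trans _ _ (P ((rectangle n B `&` N) `|`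
      (iter n (preimage (@shift (cmap R))) N `\` N)))).
    apply: le_measure; rewrite ?inE; [exact: measurableI| |].
      by apply: measurableU; [exact: measurableI|exact: measurableD].
    by move=> w [Bw Nw]; case: (pselect (N w)) => ?; [left|right].
  rewrite (le_trans (measureU2 _ _ _))//; [exact: measurableI|exact: measurableD|].
  by rewrite [X in (_ + X)%E]Nnull adde0.
(* [G] is disjoint from [N] and has positive probability, so independence leaves only [P N = 0]. *)
have := indep G measurable_bounded_variation_event.
rewrite /mrestr /mscale/= (_ : G `&` N = set0); last first.
  by apply/seteqP; split => // w [Gw]; apply; exists 0%N.
rewrite measure0 fineK ?fin_num_measure// => /esym/eqP.
by rewrite mule_eq0 (gt_eqF hbv) orbF => /eqP.
Qed.

End bounded_variation_event.

(** * Oscillations on disjoint intervals *)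

Section oscillation.
Variable R : realType.
Implicit Types (x y : unitI R) (M : R) (H : nat -> unitI R -> unitI R).

Definition order_convex (I : set (unitI R)) :=
  forall x y z, I x -> I z -> uval x <= uval y <= uval z -> I y.

(** The index type is an arbitrary finite type, so that a subfamily indexed by a subtype can be used
    directly. *)
Definition osc_bound H (r : R) (K : nat) :=
  forall n (T : finType) (I : T -> set (unitI R)),
  (forall i, order_convex (I i)) ->
  (forall i j x, I i x -> I j x -> i = j) ->
  (forall i, exists x y,
     [/\ I i x, I i y & r <= `|uval (H n x) - uval (H n y)|]) ->
  (#|T| <= K)%N.

(** Unlike bounded variation, this condition is preserved by composing on the left with a map that
    is merely continuous. *)
Definition osc_bounded H := forall r : R, 0 < r -> exists K, osc_bound H r K.

(** Each interval with oscillation at least [r] uses up at least [r] of the variation, so there are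
    at most [M / r] of them. *)
Lemma osc_bounded_variation H M :
  (forall n, continuous (H n)) ->
  (forall n m, grid_variation (H n) m <= M) -> osc_bounded H.
Proof.
move=> cH HM r r0; exists (Num.truncn (M / r)) => n T I Icvx Idis Iosc.
have /choice[p Ip] i : exists p : unitI R * unitI R,
    [/\ I i p.1, I i p.2, uval p.1 <= uval p.2 &
        r <= `|uval (H n p.2) - uval (H n p.1)|].
  have [x [y [Ix Iy rxy]]] := Iosc i.
  have [xy|/ltW yx] := leP (uval x) (uval y); last by exists (y, x).
  by exists (x, y); split => //; rewrite distrC.
have sM : \sum_i `|uval (H n (p i).2) - uval (H n (p i).1)| <= M.
  apply: (sum_increments_le (cH n) (HM n)) => [i|i j t]; first by have [] := Ip i.
  have [Ii1 Ii2 _ _] := Ip i; have [Ij1 Ij2 _ _] := Ip j.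
  move=> /andP[it ti] /andP[jt tj].
  have tE : uval (clamp t) = t.
    by rewrite clampE// (le_trans (uval_ge0 _) (ltW it)) (le_trans ti (uval_le1 _)).
  apply: (Idis i j (clamp t)).
    by apply: (Icvx i (p i).1 _ (p i).2) => //; rewrite tE (ltW it).
  by apply: (Icvx j (p j).1 _ (p j).2) => //; rewrite tE (ltW jt).
have TM : #|T|%:R <= M / r.
  rewrite ler_pdivlMr//; apply: le_trans sM.
  rewrite mulr_natl -sumr_const; apply: ler_sum => i _.
  by have [] := Ip i.
by rewrite truncn_ge_nat// (le_trans _ TM).
Qed.

Lemma unitI_compact : compact [set: unitI R].
Proof.
rewrite (_ : [set: _] = @clamp R @` `[0, 1]).
  apply: continuous_compact; last exact: segment_compact.
  by apply: continuous_subspaceT; exact: clamp_continuous.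
apply/seteqP; split => // x _; exists (uval x); last exact: clamp_uval.
by rewrite /= in_itv /= uval_ge0 uval_le1.
Qed.

(** Heine's theorem: near-covering compactness turns the moduli of continuity at the points into a
    common one. *)
Lemma cmap_unif_continuous (g : cmap R) (r : R) : 0 < r ->
  exists2 d : R, 0 < d & forall x y, `|uval x - uval y| < d ->
    `|uval (g x) - uval (g y)| < r.
Proof.
move=> r0; pose Q (d : R) x := forall y, `|uval x - uval y| < d ->
    `|uval (g x) - uval (g y)| < r.
have := unitI_compact; rewrite compact_near_coveringP => nc.
have : \forall d \near (0 : R)^'+, [set: unitI R] `<=` Q d.
  apply: nc => x _; have [|d d0 gd] := @cmap_cvg R g x (r / 2).
    by rewrite divr_gt0.
  exists (ball x (d / 2), [set e | e < d / 2]).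
    split => /=; first by apply: nbhsx_ballx; rewrite divr_gt0.
    by apply: nbhs_right_lt; rewrite divr_gt0.
  move=> [x' e] /= [xx' ed] y x'y.
  rewrite unitI_ballE in xx'.
  rewrite [r]splitr (le_lt_trans (ler_distD (uval (g x)) _ _))// ltrD//.
    by rewrite distrC; apply: gd; apply: lt_trans xx' _; rewrite ltr_pdivrMr// ltr_pMr// ltr1n.
  apply: gd; rewrite [d]splitr (le_lt_trans (ler_distD (uval x') _ _))// ltrD//.
  exact: lt_trans x'y ed.
move=> /(filterI (nbhs_right_gt (0 : R)))/filter_ex[d [d0 Qd]].
by exists d => // x; exact: Qd.
Qed.

Lemma grid_variation_id m : grid_variation (@idfun (unitI R)) m <= 1.
Proof.
rewrite /grid_variation big_mkord (eq_bigr (fun=> m.+1%:R^-1)) => [|j _].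
  by rewrite sumr_const card_ord -[X in X *+ _]mul1r -mulrnAr -mulr_natl divff ?mulr1.
have jE k : (k <= m.+1)%N -> uval (grid R m k) = k%:R / m.+1%:R.
  by move=> km; rewrite clampE// divr_ge0//= ler_pdivrMr// mul1r ler_nat.
rewrite !jE ?(ltnW (ltn_ord j))//= -mulrBl -natr1 addrAC subrr add0r mul1r ger0_norm//.
Qed.

(** By uniform continuity of the outermost map, an oscillation of at least [r] after it comes from
    one of at least [d] before it. *)
Lemma osc_bounded_shift (w : nat -> cmap R) :
  osc_bounded (comp_prefix (shift w)) -> osc_bounded (comp_prefix w).
Proof.
move=> Ow r r0.
have [d d0 wd] := cmap_unif_continuous (w 0%N) r0.
have [K HK] := Ow d d0.
(* The empty composition has no outermost map; it is the identity, of variation 1, and gets its own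
   bound [K0]. *)
have [|n m|K0 HK0] := @osc_bounded_variation (fun=> idfun) 1 _ _ r r0.
- by move=> _ x; exact: cvg_id.
- exact: grid_variation_id.
exists (maxn K K0) => -[|n] T I Icvx Idis Iosc; rewrite leq_max.
  by apply/orP; right; apply: (HK0 0%N T I).
apply/orP; left; apply: (HK n T I) => // i.
have [x [y [Ix Iy rxy]]] := Iosc i; exists x, y; split => //.
rewrite leNgt; apply/negP => /wd; rewrite ltNge => /negP; apply.
by move: rxy; rewrite !comp_prefixS.
Qed.

Lemma osc_bounded_iter_shift (w : nat -> cmap R) (A : set (nat -> cmap R)) :
  A `<=` [set w | osc_bounded (comp_prefix w)] ->
  forall j, iter j (preimage (@shift (cmap R))) A `<=`
    [set w | osc_bounded (comp_prefix w)].
Proof.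
by move=> AO; elim=> // j IH v /IH; exact: osc_bounded_shift.
Qed.

Lemma eventually_bv_osc (mu : probability (borel (cmap R)) R) :
  eventually_bv mu `<=` [set w | osc_bounded (comp_prefix w)].
Proof.
move=> w [j _]; apply: osc_bounded_iter_shift => {w}//.
rewrite bounded_variation_eventE => w [_ [M _ wM]].
(* The event controls compositions of positive length only; the 1 accounts for the identity at
   length 0. *)
apply: (@osc_bounded_variation _ (Num.max 1 M%:R)) => [n|[|n] m].
- exact: comp_prefix_continuous.
- by rewrite le_max grid_variation_id.
- by rewrite le_max wM orbT.
Qed.

End oscillation.

(** * Banach limits *)

Section banach_limit.
Variable R : realType.
Implicit Types u v : nat -> R.

Definition bounded_seq u := exists M : R, forall n, `|u n| <= M.

Definition cesaro u (N : nat) : R := (\sum_(n < N.+1) u n) / N.+1%:R.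

(** [L] is a total function, but its values matter only on bounded sequences, where the limits that
    define it exist. *)
Record banach_limit (L : (nat -> R) -> R) : Prop := BanachLimit {
  blimD : forall u v, bounded_seq u -> bounded_seq v ->
    L (u \+ v) = L u + L v ;
  blimZ : forall (c : R) u, bounded_seq u -> L (fun n => c * u n) = c * L u ;
  blim_le : forall u v, bounded_seq u -> bounded_seq v ->
    (forall n, u n <= v n) -> L u <= L v ;
  blim_cst : forall c : R, L (fun=> c) = c ;
  blim_shift : forall u, bounded_seq u -> L (fun n => u n.+1) = L u }.

(** Compactness of the segment gives a cluster point, and an ultrafilter converges to each of its
    cluster points. *)
Lemma ultra_cvg_bounded (F : set_system nat) u : UltraFilter F ->
  bounded_seq u -> cvg (u n @[n --> F]).
Proof.
move=> UF [M uM]; have PF := @ultra_proper _ _ UF.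
have cM : compact `[- M, M] := @segment_compact R _ _.
have [|p [_ clp]] := cM (u n @[n --> F]) _ _.
  by apply: (@filterS _ F _ setT) => [n _|]; [rewrite /= in_itv /= -ler_norml|exact: filterT].
apply/cvg_ex; exists p => V pV.
have [//|nV] := in_ultra_setVsetC (u @^-1` V) UF.
have [q [nVq Vq]] := clp (~` V) V nV pV.
by have := nVq Vq.
Qed.

Lemma cesaro_bounded u : bounded_seq u -> bounded_seq (cesaro u).
Proof.
move=> [M uM]; exists M => N; rewrite normrM (ger0_norm (_ : 0 <= N.+1%:R^-1))//.
rewrite ler_pdivrMr// (le_trans (ler_norm_sum _ _ _))//.
rewrite (le_trans (ler_sum _ (fun (i : 'I_N.+1) _ => uM i)))//.
by rewrite sumr_const card_ord mulr_natr.
Qed.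

(** Cesaro means are taken to their limit along an ultrafilter finer than the one at infinity. Shift
    invariance comes from the averaging: a shift changes the mean of index [N] by
    [(u N.+1 - u 0) / N.+1], which tends to 0. *)
Lemma exists_banach_limit : exists L, banach_limit L.
Proof.
have [F [UF ooF]] := ultraFilterLemma (@eventually_filter).
have PF := @ultra_proper _ _ UF.
have cvgF u : bounded_seq u -> cvg (cesaro u n @[n --> F]).
  by move=> /cesaro_bounded; exact: ultra_cvg_bounded.
exists (fun u => lim (cesaro u n @[n --> F])); split.
- move=> u v bu bv; apply/cvg_lim => //.
  rewrite (_ : cesaro (u \+ v) = cesaro u \+ cesaro v); last first.
    by apply/funext => N; rewrite /cesaro big_split/= mulrDl.
  by apply: cvgD; exact: cvgF.
- move=> c u bu; apply/cvg_lim => //.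
  rewrite (_ : cesaro _ = fun n => c * cesaro u n); last first.
    by apply/funext => N; rewrite /cesaro -mulr_sumr mulrA.
  by apply: cvgMr; exact: cvgF.
- move=> u v bu bv uv; apply: ler_lim; [exact: cvgF|exact: cvgF|].
  apply: (@filterS _ F _ setT) => [N _|]; last exact: filterT.
  by rewrite /cesaro ler_pM2r ?invr_gt0// ler_sum.
- move=> c; apply/cvg_lim => //.
  rewrite (_ : cesaro _ = fun=> c); first exact: cvg_cst.
  by apply/funext => N; rewrite /cesaro sumr_const card_ord -(mulr_natr c) mulfK.
move=> u bu; apply/cvg_lim => //.
rewrite (_ : cesaro _ = cesaro u \+
  (fun N => (u N.+1 - u 0%N) / N.+1%:R)); last first.
  apply/funext => N; rewrite /cesaro /= -mulrDl; congr (_ / _).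
  rewrite big_ord_recr/= [in RHS]big_ord_recl/=; under [in RHS]eq_bigr do rewrite /bump/= add1n.
  by ring.
rewrite -[X in _ --> X]addr0; apply: cvgD; first exact: cvgF.
have c0 : (u N.+1 - u 0%N) / N.+1%:R @[N --> \oo] --> (0 : R).
  have [M uM] := bu.
  apply/cvgr0Pnorm_le => e e0.
  have : \forall N \near \oo, N.+1%:R^-1 * (M + M) <= e.
    have M0 : 0 <= M by apply: le_trans (uM 0%N).
    have M1 : 0 < M + M + 1 by rewrite ltr_wpDl ?addr_ge0.
    have := near_infty_natSinv_lt (PosNum (divr_gt0 e0 M1)).
    apply: filterS => N /= /ltW; rewrite ler_pdivlMr// => /(le_trans _); apply.
    by rewrite ler_pM2l ?invr_gt0// lerDl.
  apply: filterS => N; apply: le_trans; rewrite normrM.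
  rewrite (ger0_norm (_ : 0 <= N.+1%:R^-1))// mulrC ler_pM2l ?invr_gt0//.
  by rewrite (le_trans (ler_normB _ _))// lerD.
by apply: cvg_trans c0 => A; exact: ooF.
Qed.

End banach_limit.

(** * Setwise Banach limits of dominated probability measures *)

Section banach_limit_measure.
Context d (T : measurableType d) (R : realType).
Variables (L : (nat -> R) -> R) (hL : banach_limit L).
Variables (q : nat -> probability T R) (kappa : {measure set T -> \bar R}).
Hypothesis kappa_fin : (kappa setT < +oo)%E.
Hypothesis q_le : forall n A, measurable A -> (q n A <= kappa A)%E.

Let a (A : set T) : R := L (fun n => fine (q n A)).

Let q_bounded A : measurable A -> bounded_seq (fun n => fine (q n A)).
Proof.
move=> mA; exists 1 => n; rewrite ger0_norm ?fine_ge0// -lee_fin fineK.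
  exact: probability_le1.
exact: fin_num_measure.
Qed.

Let a_ge0 A : measurable A -> 0 <= a A.
Proof.
move=> mA; rewrite -(blim_cst hL 0); apply: (blim_le hL).
- by exists 0 => n; rewrite normr0.
- exact: q_bounded.
- by move=> n; rewrite fine_ge0.
Qed.

Let aU A B : measurable A -> measurable B -> A `&` B = set0 ->
  a (A `|` B) = a A + a B.
Proof.
move=> mA mB AB; rewrite -(blimD hL); [|exact: q_bounded..].
congr L; apply/funext => n /=; rewrite measureU//.
by rewrite fineD// fin_num_measure.
Qed.

Let kappa_fin_num A : measurable A -> kappa A \is a fin_num.
Proof.
move=> mA; rewrite ge0_fin_numE//; apply: le_lt_trans kappa_fin.
by apply: le_measure; rewrite ?inE.
Qed.

Let a_le A : measurable A -> a A <= fine (kappa A).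
Proof.
move=> mA; rewrite -[leRHS](blim_cst hL); apply: (blim_le hL).
- exact: q_bounded.
- by exists `|fine (kappa A)|.
- move=> n; apply: fine_le; [exact: fin_num_measure|exact: kappa_fin_num|].
  exact: q_le.
Qed.

(* The absolute value only matters on non-measurable sets. *)
Definition blim_measure (_ : banach_limit L) (_ : (kappa setT < +oo)%E)
    (_ : forall n A, measurable A -> (q n A <= kappa A)%E) : set T -> \bar R :=
  fun A => (`|L (fun n => fine (q n A))|)%:E.

Local Notation m := (blim_measure hL kappa_fin q_le).

Lemma blim_measureE A : measurable A ->
  m A = (L (fun n => fine (q n A)))%:E.
Proof. by move=> mA; rewrite /blim_measure ger0_norm// a_ge0. Qed.

Let m0 : m set0 = 0%E.
Proof.
rewrite blim_measureE// -[RHS]/(0%:E) -(blim_cst hL 0); congr (L _)%:E.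
by apply/funext => n; rewrite measure0.
Qed.

Let m_ge0 A : (0 <= m A)%E.
Proof. by rewrite lee_fin. Qed.

(** A Banach limit is only finitely additive; countable additivity holds because the mass of the
    tails is at most their [kappa]-mass, which tends to 0. *)
Let m_sigma_additive : semi_sigma_additive m.
Proof.
move=> F mF tF mUF.
pose B n := \big[setU/set0]_(i < n) F i.
have mB n : measurable (B n) by apply: bigsetU_measurable.
have mtail n : measurable (\bigcup_i F i `\` B n) by exact: measurableD.
have aB n : a (B n) = \sum_(i < n) a (F i).
  elim: n => [|n IH].
    by rewrite /B !big_ord0; apply: EFin_inj; rewrite -blim_measureE.
  have BF : B n `&` F n = set0.
    apply/seteqP; split => // x []; rewrite /B -bigcup_mkord => -[k /= kn Fkx] Fnx.
    have /trivIsetP/(_ k n I I) := tF; rewrite ltn_eqF// => /(_ isT) FF.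
    by have : (F k `&` F n) x by []; rewrite FF.
  by rewrite {1}/B !big_ord_recr/= -/(B n) aU// IH.
have aUF n : a (\bigcup_i F i) = \sum_(i < n) a (F i) + a (\bigcup_i F i `\` B n).
  rewrite -aB -aU//; last by apply/seteqP; split => // x [Bx [_ /(_ Bx)]].
  rewrite setDUK// => x; rewrite /B -bigcup_mkord => -[k _ Fkx].
  by exists k.
have ktail : fine (kappa (\bigcup_i F i `\` B n)) @[n --> \oo] --> (0 : R).
  have : kappa (\bigcup_i F i `\` B n) @[n --> \oo] -->
      kappa (\bigcap_n (\bigcup_i F i `\` B n)).
    apply: nonincreasing_cvg_mu => //.
    - by rewrite ltey_eq kappa_fin_num.
    - exact: bigcapT_measurable.
    - move=> i j ij; apply/subsetPset; apply: setDS.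
      by apply: subset_bigsetU.
  rewrite (_ : \bigcap_n _ = set0).
    by rewrite measure0 => /fine_cvg.
  apply/seteqP; split => // x Fx; have [[k _ Fkx] _] := Fx 0%N I.
  have [_ /=] := Fx k.+1 I; apply.
  by rewrite /B -bigcup_mkord; exists k => /=.
rewrite blim_measureE// (_ : (fun n => _) = EFin \o (fun n => \sum_(i < n) a (F i))).
  apply: cvg_EFin; first exact: nearW.
  rewrite [X in X @ _ --> _](_ : _ = fun n => \sum_(i < n) a (F i)) //.
  have lo : a (\bigcup_i F i) - fine (kappa (\bigcup_i F i `\` B n)) @[n --> \oo]
      --> a (\bigcup_i F i).
    by rewrite -[X in _ --> X]subr0; apply: cvgB => //; exact: cvg_cst.
  apply: (squeeze_cvgr _ lo (cvg_cst (a (\bigcup_i F i)))).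
  apply: nearW => n; rewrite [X in X - _](aUF n) [X in _ && (_ <= X)](aUF n).
  by rewrite lerDl a_ge0// andbT -addrA gerDl subr_le0 a_le.
apply/funext => n /=; rewrite big_mkord -sumEFin; apply: eq_bigr => i _.
exact: blim_measureE.
Qed.

HB.instance Definition _ :=
  isMeasure.Build _ _ _ m m0 m_ge0 m_sigma_additive.

Let mT : m setT = 1%E.
Proof.
rewrite blim_measureE// -[RHS]/(1%:E) -(blim_cst hL 1); congr (L _)%:E.
by apply/funext => n; rewrite probability_setT.
Qed.

HB.instance Definition _ := Measure_isProbability.Build _ _ _ m mT.

End banach_limit_measure.

(** * The random walk of compositions *)

Section conditional_probability.
Context d (T : measurableType d) (R : realType).
Variables (nu : probability T R) (I : set T) (mI : measurable I).

(** The final [nu] is the default value for a null [I], so that this is a probability in all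
    cases. *)
Definition cond_prob : set T -> \bar R := mnormalize (mrestr nu mI) nu.

HB.instance Definition _ := Probability.on cond_prob.

Lemma cond_probE A : measurable A -> (0 < nu I)%E ->
  cond_prob A = (nu (A `&` I) * (fine (nu I))^-1%:E)%E.
Proof.
move=> mA I0; rewrite /cond_prob /mnormalize/= /mrestr setTI gt_eqF//=.
by rewrite lt_eqF// ltey_eq fin_num_measure.
Qed.

End conditional_probability.

Lemma product_measure1_le d1 d2 (T1 : measurableType d1)
    (T2 : measurableType d2) (R : realType) (mu : probability T1 R)
    (q nu : probability T2 R) (c : R) : 0 <= c ->
  (forall A, measurable A -> (q A <= c%:E * nu A)%E) ->
  forall X, measurable X -> ((mu \x q) X <= c%:E * (mu \x nu) X)%E.
Proof.
move=> c0 qnu X mX; rewrite /product_measure1 -ge0_integralZl//=; last first.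
  exact: measurable_fun_xsection.
apply: ge0_le_integral => //.
- exact: measurable_fun_xsection.
- by apply: measurable_funeM; exact: measurable_fun_xsection.
- by move=> g _ /=; apply: qnu; exact: measurable_xsection.
Qed.

Section random_walk.
Variable R : realType.
Variables (mu : probability (borel (cmap R)) R).
Local Open Scope ereal_scope.
Implicit Types (q nu : probability (borel (unitI R)) R)
  (A : set (borel (unitI R))).

Let eval (p : borel (cmap R) * borel (unitI R)) : borel (unitI R) :=
  (p.1 : cmap R) p.2.

Let measurable_preimage_eval A : measurable A -> measurable (eval @^-1` A).
Proof. by move=> mA; rewrite -[X in measurable X]setTI; exact: measurable_eval. Qed.

Lemma measurable_cmap_preimage (g : cmap R) A :
  measurable A -> measurable (g @^-1` A : set (borel (unitI R))).
Proof.
move=> mA; have -> : (g @^-1` A : set (borel (unitI R))) = xsection (eval @^-1` A) g.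
  by apply/seteqP; split => x; rewrite /xsection /= inE.
by apply: measurable_xsection; exact: measurable_preimage_eval.
Qed.

Lemma measurable_fun_cmap_preimage q A : measurable A ->
  measurable_fun setT (fun g : borel (cmap R) => q ((g : cmap R) @^-1` A)).
Proof.
move=> mA; have := measurable_fun_xsection q (measurable_preimage_eval mA).
apply: eq_measurable_fun => g _ /=; congr (q _).
by apply/seteqP; split => x; rewrite /xsection /= inE.
Qed.

(** One step of the Markov chain that applies a random map of law [mu]; its fixed points are the
    invariant measures once the support has full mass ([step_invariantP]). *)
Definition step q : probability (borel (unitI R)) R :=
  pushprob (mu \x q) (@measurable_eval R).

Lemma stepE q A : step q A = \int[mu]_g q ((g : cmap R) @^-1` A).
Proof.
rewrite /step/= /pushprob /pushforward /product_measure1.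
apply: eq_integral => g _ /=; congr (q _).
by apply/seteqP; split => x; rewrite /xsection /= inE.
Qed.

Lemma eq_step q1 q2 : (forall A, measurable A -> q1 A = q2 A) ->
  forall A, measurable A -> step q1 A = step q2 A.
Proof.
move=> q12 A mA; rewrite !stepE; apply: eq_integral => g _.
by apply: q12; exact: measurable_cmap_preimage.
Qed.

Lemma step_suppE q A : mu (supp mu) = 1 -> measurable A ->
  step q A = \int[mu]_(g in supp mu) q ((g : cmap R) @^-1` A).
Proof.
move=> suppT mA; have mS := measurable_supp mu.
rewrite stepE (@ge0_negligible_integral _ _ _ mu setT (~` supp mu))//.
- by rewrite setTD setCK.
- exact: measurableC.
- exact: measurable_fun_cmap_preimage.
- by rewrite [LHS](probability_setC mu mS) suppT subee.
Qed.

Lemma step_invariantP nu : mu (supp mu) = 1 ->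
  mu_invariant mu nu <-> (forall A, measurable A -> step nu A = nu A).
Proof.
move=> suppT; split => inv A mA; first by rewrite step_suppE// -inv.
by rewrite -step_suppE// inv.
Qed.

Lemma step_le q nu (c : R) : (0 <= c)%R ->
  (forall A, measurable A -> q A <= c%:E * nu A) ->
  forall A, measurable A -> step q A <= c%:E * step nu A.
Proof.
move=> c0 qnu A mA.
exact: (product_measure1_le mu c0 qnu (measurable_preimage_eval mA)).
Qed.

Variables (P : probability (seq_space (cmap R)) R).

(* The law of g_1 ... g_n x, for x of law q independent of the i.i.d. g_i. *)
Definition walk q n : probability (borel (unitI R)) R :=
  pushprob (P \x q) (@measurable_comp_prefix R n).

Let measurable_preimage_comp_prefix n A : measurable A ->
  measurable ((fun p : seq_space (cmap R) * borel (unitI R) =>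
    comp_prefix p.1 n p.2 : borel (unitI R)) @^-1` A).
Proof.
by move=> mA; rewrite -[X in measurable X]setTI; exact: measurable_comp_prefix.
Qed.

Lemma measurable_comp_prefix_preimage (w : nat -> cmap R) n A :
  measurable A -> measurable (comp_prefix w n @^-1` A : set (borel (unitI R))).
Proof.
move=> mA; elim: n => //= n IH.
exact: (@measurable_cmap_preimage (w n) (comp_prefix w n @^-1` A)) IH.
Qed.

Lemma measurable_fun_comp_prefix_preimage q n A : measurable A ->
  measurable_fun setT
    (fun w : seq_space (cmap R) => q (comp_prefix w n @^-1` A)).
Proof.
move=> mA; have := measurable_fun_xsection q (measurable_preimage_comp_prefix n mA).
apply: eq_measurable_fun => w _ /=; congr (q _).
by apply/seteqP; split => x; rewrite /xsection /= inE.
Qed.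

Lemma walkE q n A : walk q n A = \int[P]_w q (comp_prefix w n @^-1` A).
Proof.
rewrite /walk/= /pushprob /pushforward /product_measure1.
apply: eq_integral => w _ /=; congr (q _).
by apply/seteqP; split => x; rewrite /xsection /= inE.
Qed.

Lemma walk0 q A : walk q 0 A = q A.
Proof.
rewrite walkE (eq_integral (cst (q A)))//.
by rewrite integral_cst// [X in _ * X](probability_setT P) mule1.
Qed.

Lemma eq_walk q1 q2 n : (forall A, measurable A -> q1 A = q2 A) ->
  forall A, measurable A -> walk q1 n A = walk q2 n A.
Proof.
move=> q12 A mA; rewrite !walkE; apply: eq_integral => w _.
by apply: q12; exact: measurable_comp_prefix_preimage.
Qed.

Hypothesis hP : is_infinite_product mu P.

(** The outermost map is independent of the composition of the others, which is a composition along
    the shifted sequence. So, although the compositions are backward, their one-point laws are those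
    of the Markov chain. *)
Lemma walkS q n A : measurable A -> walk q n.+1 A = step (walk q n) A.
Proof.
move=> mA; rewrite walkE stepE.
pose Q : probability (seq_space (cmap R)) R :=
  pushprob (mu \x P) (@measurable_seq_cons (cmap R)).
rewrite (@eq_measure_integral _ _ _ _ Q)/=; last first.
  by move=> B mB _; exact: (product_cons hP).
have mf : measurable_fun setT (fun w : seq_space (cmap R) =>
    q (comp_prefix w n.+1 @^-1` A)) by exact: measurable_fun_comp_prefix_preimage.
have mc := @measurable_seq_cons (cmap R).
rewrite [LHS](_ : _ = \int[mu \x P]_p
    q (comp_prefix (seq_cons p.1 p.2) n.+1 @^-1` A)); last first.
  by apply: (ge0_integral_pushforward mc) => //; rewrite preimage_setT.
rewrite fubini_tonelli1//; last exact: (measurableT_comp mf mc).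
apply: eq_integral => g _; rewrite /fubini_F [RHS]walkE; apply: eq_integral => w _.
have gw : comp_prefix (seq_cons g w) n.+1 = g \o comp_prefix w n.
  by apply/funext => x; rewrite comp_prefixS.
exact: (congr1 (fun f : unitI R -> unitI R => q (f @^-1` A)) gw).
Qed.

End random_walk.

(** * Banach limits of the walk *)

Section ergodic_average.
Variable R : realType.
Variables (mu : probability (borel (cmap R)) R).
Variables (P : probability (seq_space (cmap R)) R).
Hypothesis hP : is_infinite_product mu P.
Hypothesis suppT : mu (supp mu) = 1%E.
Variables (L : (nat -> R) -> R) (hL : banach_limit L).
Local Open Scope ereal_scope.
Implicit Types (q nu : probability (borel (unitI R)) R)
  (A : set (borel (unitI R))).

Lemma walk_bounded q A : measurable A ->
  bounded_seq (fun n => fine (walk P q n A)).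
Proof.
move=> mA; exists 1%R => n; rewrite ger0_norm ?fine_ge0// -lee_fin fineK.
  exact: probability_le1.
exact: fin_num_measure.
Qed.

Lemma walk_invariant nu n A : mu_invariant mu nu -> measurable A ->
  walk P nu n A = nu A.
Proof.
move=> /(step_invariantP nu suppT) inv; elim: n A => [|n IH] A mA.
  by rewrite walk0.
by rewrite (walkS hP)// -[RHS]inv//; apply: eq_step.
Qed.

Lemma walk_le q nu (c : R) n A : (0 <= c)%R -> mu_invariant mu nu ->
  (forall A, measurable A -> q A <= c%:E * nu A) -> measurable A ->
  walk P q n A <= c%:E * nu A.
Proof.
move=> c0 inv qnu; elim: n A => [|n IH] A mA; first by rewrite walk0 qnu.
rewrite (walkS hP)//; have /(step_invariantP nu suppT) sinv := inv.
by rewrite -[X in _ <= _ * X]sinv//; apply: step_le.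
Qed.

(* The Banach limit commutes with products: both sides are measures on the
   product space which agree on rectangles. *)
Lemma exists_invariant_limit q nu (c : R) : (0 <= c)%R ->
  (forall n A, measurable A -> walk P q n A <= c%:E * nu A) ->
  exists2 m : probability (borel (unitI R)) R, mu_invariant mu m &
    forall A, measurable A -> m A = (L (fun n => fine (walk P q n A)))%:E.
Proof.
move=> c0 qnu.
pose kappa := mscale (NngNum c0) nu.
have kT : kappa setT < +oo.
  by rewrite /kappa/= /mscale/= (probability_setT nu) mule1 ltry.
pose m : probability (borel (unitI R)) R :=
  blim_measure (q := walk P q) (kappa := kappa) hL kT qnu.
have mE A : measurable A -> m A = (L (fun n => fine (walk P q n A)))%:E.
  exact: blim_measureE.
exists m => //; apply/step_invariantP => // A mA.
(* The laws of the pairs (next map, current point), before evaluation, are dominated in the same way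
   and so have a Banach limit [m2] that is a measure. *)
pose kappa2 := mscale (NngNum c0) (mu \x nu).
have k2T : kappa2 setT < +oo.
  by rewrite /kappa2/= /mscale/= (probability_setT (mu \x nu)) mule1 ltry.
pose q2 n : probability (borel (cmap R) * borel (unitI R))%type R := mu \x walk P q n.
have q2le n X : measurable X -> q2 n X <= kappa2 X.
  exact: (@product_measure1_le _ _ _ _ R mu (walk P q n) nu c c0 (qnu n) X).
pose m2 : probability (borel (cmap R) * borel (unitI R))%type R :=
  blim_measure hL k2T q2le.
have m2E X : measurable X -> m2 X = (L (fun n => fine (q2 n X)))%:E.
  exact: blim_measureE.
have prodE X : measurable X -> (mu \x m) X = m2 X.
  apply: product_measure_unique => B C mB mC.
  rewrite [LHS]m2E; last exact: measurableX.
  rewrite [X in _ = _ * X]mE// -[X in _ = X * _](fineK (fin_num_measure mu B mB)) -EFinM.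
  congr (_%:E).
  rewrite -(blimZ hL); last exact: walk_bounded.
  congr L; apply/funext => n; rewrite /q2/= product_measure1E// fineM//.
    exact: fin_num_measure.
  exact: fin_num_measure.
rewrite /step/= /pushprob /pushforward [LHS]prodE; last first.
  by rewrite -[X in measurable X]setTI; exact: measurable_eval.
rewrite m2E; last by rewrite -[X in measurable X]setTI; exact: measurable_eval.
rewrite mE//; congr (_%:E).
(* One more step of the walk is absorbed by the shift invariance of [L]. *)
transitivity (L (fun n => fine (walk P q n.+1 A))); last first.
  by apply: (blim_shift hL); exact: walk_bounded.
by congr L; apply/funext => n; rewrite (walkS hP).
Qed.

Lemma cond_prob_le nu A B (mB : measurable B) : 0 < nu B -> measurable A ->
  cond_prob nu mB A <= ((fine (nu B))^-1)%:E * nu A.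
Proof.
move=> B0 mA; rewrite cond_probE// muleC lee_wpmul2l ?lee_fin ?invr_ge0 ?fine_ge0//.
by apply: le_measure; rewrite ?inE//; exact: measurableI.
Qed.

(* Conditioning on I and on its complement decomposes nu into two invariant
   probabilities, which must both be nu by extremality. *)
Lemma ergodic_limit nu A B (mB : measurable B) : mu_ergodic mu nu ->
  0 < nu B -> measurable A ->
  L (fun n => fine (walk P (cond_prob nu mB) n A)) = fine (nu A).
Proof.
move=> [inv ext] B0 mA.
have mC := measurableC mB.
pose t := fine (nu B).
have tE : nu B = t%:E by rewrite fineK// fin_num_measure.
have tC : nu (~` B) = (1 - t)%:E by rewrite probability_setC// tE.
have t0 : (0 < t)%R by rewrite -lte_fin -tE.
have nuD D : measurable D -> nu D = nu (D `&` B) + nu (D `&` ~` B).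
  by move=> mD; rewrite (measureDI nu mD mB) addeC setDE.
(* If the complement is null, it cannot be conditioned on; but then conditioning on [B] changes
   nothing and the walk is constant. *)
have [C0|C0] := eqVneq (nu (~` B)) 0.
  have t1 : t = 1%R by move/eqP: C0; rewrite tC eqe subr_eq0 => /eqP.
  have cE D : measurable D -> cond_prob nu mB D = nu D.
    move=> mD; rewrite cond_probE// tE t1/= invr1 mule1 [RHS]nuD//.
    rewrite [X in _ + X](_ : _ = 0) ?adde0//; apply/eqP.
    rewrite eq_le measure_ge0 andbT -C0; apply: le_measure; rewrite ?inE//.
    exact: measurableI.
  rewrite -[RHS](blim_cst hL); congr L; apply/funext => n.
  by rewrite (eq_walk _ _ cE)// walk_invariant.
have C1 : 0 < nu (~` B) by rewrite lt0e C0 /=.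
have t1 : (0 < 1 - t)%R by rewrite -lte_fin -tC.
have lim D (mD : measurable D) : 0 < nu D ->
    exists2 m : probability (borel (unitI R)) R, mu_invariant mu m &
    forall A, measurable A -> m A = (L (fun n => fine (walk P (cond_prob nu mD) n A)))%:E.
  move=> D0; apply: (@exists_invariant_limit _ nu (fine (nu D))^-1).
    by rewrite invr_ge0 fine_ge0.
  move=> n E mE; apply: walk_le => //; first by rewrite invr_ge0 fine_ge0.
  by move=> F mF; exact: cond_prob_le.
have [m1 inv1 m1E] := lim B mB B0.
have [m2 inv2 m2E] := lim _ mC C1.
have nuE D : measurable D ->
    nu D = t%:E * cond_prob nu mB D + (1 - t)%:E * cond_prob nu mC D.
  move=> mD; have scaleK (s : R) (x : \bar R) : (0 < s)%R -> s%:E * (x * (s^-1)%:E) = x.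
    by move=> s0; rewrite muleCA -EFinM mulfV ?gt_eqF// mule1.
  by rewrite !cond_probE// tE tC/= !scaleK// -nuD.
have walkD D n : measurable D -> nu D = t%:E * walk P (cond_prob nu mB) n D +
    (1 - t)%:E * walk P (cond_prob nu mC) n D.
  move=> mD; rewrite -[LHS](walk_invariant n inv mD) !walkE.
  rewrite -!ge0_integralZl//=; try exact: measurable_fun_comp_prefix_preimage;
    try by rewrite lee_fin ltW.
  rewrite -ge0_integralD//=.
  - by apply: eq_integral => w _; rewrite nuE//; exact: measurable_comp_prefix_preimage.
  - by move=> w _; rewrite mule_ge0// lee_fin ltW.
  - by apply: measurable_funeM; exact: measurable_fun_comp_prefix_preimage.
  - by move=> w _; rewrite mule_ge0// lee_fin ltW.
  - by apply: measurable_funeM; exact: measurable_fun_comp_prefix_preimage.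
have scale_bdd (c : R) u : bounded_seq u -> bounded_seq (fun n => c * u n)%R.
  by move=> [M uM]; exists (`|c| * M)%R => n; rewrite normrM ler_wpM2l.
have mD D : measurable D -> nu D = t%:E * m1 D + (1 - t)%:E * m2 D.
  move=> mD; rewrite m1E// m2E// -!EFinM -EFinD.
  rewrite -!(blimZ hL); [|exact: walk_bounded..].
  rewrite -(blimD hL); [|by apply: scale_bdd; exact: walk_bounded..].
  rewrite -[LHS]fineK ?fin_num_measure//; congr (_%:E).
  rewrite -[LHS](blim_cst hL); congr L; apply/funext => n /=.
  rewrite (walkD _ n mD) fineD ?fineM//; try exact: fin_num_measure;
    by rewrite fin_numM// fin_num_measure.
(* Two different limits would decompose [nu] properly; as they agree, the convex combination [mD]
   reduces to [m1]. *)
have m12 : measure_eq m1 m2.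
  apply: contrapT => m12; apply: ext; exists m1, m2, t; split => //.
  by rewrite t0/= -subr_gt0.
apply: EFin_inj; rewrite -m1E// fineK ?fin_num_measure// mD// -m12//.
rewrite -ge0_muleDl ?lee_fin ?ltW// -EFinD addrC subrK.
exact/esym/mul1e.
Qed.

End ergodic_average.

(** * Ergodic measures charging many intervals *)

Section separation.
Variable R : realType.
Variables (mu : probability (borel (cmap R)) R).
Variables (P : probability (seq_space (cmap R)) R).
Hypothesis hP : is_infinite_product mu P.
Hypothesis hbv : (0 < P (bounded_variation_event mu))%E.
Implicit Types nu : probability (borel (unitI R)) R.

Definition charged_intervals nu1 nu2 (k : nat) (I : 'I_k -> set (unitI R)) :=
  [/\ forall i, measurable (I i : set (borel (unitI R))),
      forall i, order_convex (I i),
      forall i j x, I i x -> I j x -> i = j,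
      forall i, (0 < nu1 (I i))%E & forall i, (0 < nu2 (I i))%E].

(** The points at distance at least [r] from the complement of [U]: a closed set, which increases to
    an open [U] as [r] decreases to 0. *)
Definition inner (U : set (unitI R)) (r : R) : set (unitI R) :=
  ~` \bigcup_(y in ~` U) ball y r.

Lemma measurable_inner U r : measurable (inner U r : set (borel (unitI R))).
Proof.
apply: measurableC; apply: open_measurable_borel; apply: bigcup_open => y _.
exact: unitI_ball_open.
Qed.

Lemma innerP U r x y : inner U r x -> `|uval x - uval y| < r -> U y.
Proof.
move=> Ux xy; apply: contrapT => Uy; apply: Ux; exists y => //.
by rewrite unitI_ballE distrC.
Qed.

Lemma inner_approx nu (U : set (unitI R)) (a : \bar R) : open U ->
  (a < nu U)%E -> exists2 r : R, 0 < r & (a < nu (inner U r))%E.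
Proof.
move=> oU aU.
have iU : \bigcup_l inner U l.+1%:R^-1 = U.
  apply/seteqP; split => [x [l _ lx]|x Ux].
    by apply: (innerP lx); rewrite subrr normr0.
  have /nbhs_ballP[e /= e0 eU] : nbhs x U by exact: open_nbhs_nbhs.
  have [l _ le] := near_infty_natSinv_lt (PosNum e0).
  exists l => // -[y Uy]; rewrite unitI_ballE => yx; apply: Uy; apply: eU.
  by rewrite unitI_ballE distrC (lt_trans yx)// (le l (leqnn l)).
have mi l : measurable (inner U l.+1%:R^-1 : set (borel (unitI R))).
  exact: measurable_inner.
have cv : nu (inner U l.+1%:R^-1) @[l --> \oo] --> nu U.
  rewrite -[X in _ --> nu X]iU; apply: nondecreasing_cvg_mu => //.
    exact: bigcupT_measurable.
  move=> l l' ll'; apply/subsetPset => x lx -[y Uy]; rewrite unitI_ballE => yx.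
  apply: lx; exists y => //; rewrite unitI_ballE (lt_le_trans yx)//.
  by rewrite lef_pV2 ?posrE// ler_nat ltnS.
have [l al] : exists l, (a < nu (inner U l.+1%:R^-1))%E.
  apply: contrapT => /forallNP na; move: aU; rewrite ltNge => /negP; apply.
  rewrite -(cvg_lim _ cv)//; apply: lime_le; first by apply/cvg_ex; eexists; exact: cv.
  by apply: nearW => l; rewrite leNgt; apply/negP; exact: na.
by exists l.+1%:R^-1.
Qed.

(** Boundedness is proved in the same induction because the additivity of [L] requires it at each
    step. *)
Lemma blim_sum (L : (nat -> R) -> R) (I : Type) (s : seq I) (u : I -> nat -> R) :
  banach_limit L -> (forall i, bounded_seq (u i)) ->
  bounded_seq (fun n => \sum_(i <- s) u i n) /\
  L (fun n => \sum_(i <- s) u i n) = \sum_(i <- s) L (u i).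
Proof.
move=> hL bu; elim: s => [|i s [bs Ls]].
  rewrite big_nil -[RHS](blim_cst hL); split.
    by exists 0 => n; rewrite big_nil normr0.
  by congr L; apply/funext => n; rewrite big_nil.
have E : (fun n => \sum_(j <- i :: s) u j n) = u i \+ (fun n => \sum_(j <- s) u j n).
  by apply/funext => n; rewrite big_cons.
rewrite E big_cons (blimD hL)// Ls; split => //.
have [M uM] := bu i; have [N sN] := bs; exists (M + N) => n.
by rewrite (le_trans (ler_normD _ _))// lerD.
Qed.

(* If h oscillates by less than r on an interval J, then either h J avoids the
   r-interior of U, or h J is contained in U. *)
Lemma cond_prob_inner_le nu1 nu2 (U : set (unitI R)) (r : R) (J : set (unitI R))
    (mJ : measurable (J : set (borel (unitI R)))) (h : unitI R -> unitI R) :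
  measurable (h @^-1` U : set (borel (unitI R))) ->
  measurable (h @^-1` inner U r : set (borel (unitI R))) ->
  (0 < nu1 J)%E -> (0 < nu2 J)%E ->
  (forall x y, J x -> J y -> `|uval (h x) - uval (h y)| < r) ->
  (cond_prob nu1 mJ (h @^-1` inner U r) <= cond_prob nu2 mJ (h @^-1` U))%E.
Proof.
move=> mU mi J1 J2 osc.
have [[x [Jx hx]]|none] := pselect (exists x, J x /\ inner U r (h x)).
  rewrite [leRHS](_ : _ = 1%E) ?probability_le1//.
  rewrite cond_probE// (_ : _ `&` J = J).
    by rewrite -[X in (X * _)%E]fineK ?fin_num_measure// -EFinM mulfV// gt_eqF//
      fine_gt0// J2 ltey_eq fin_num_measure.
  rewrite setIidr// => y Jy; apply: (innerP hx); exact: osc.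
rewrite cond_probE// (_ : _ `&` J = set0) ?measure0 ?mul0e//.
by apply/seteqP; split => // x [hx Jx]; apply: none; exists x.
Qed.

(** By [cond_prob_inner_le], the positive part vanishes on every interval where the composition
    oscillates by less than [r]. *)
Let W nu1 nu2 (U : set (unitI R)) (r : R) k (I : 'I_k -> set (unitI R))
    (mI : forall i, measurable (I i : set (borel (unitI R)))) n
    (w : seq_space (cmap R)) (i : 'I_k) : R :=
  Num.max 0 (fine (cond_prob nu1 (mI i) (comp_prefix w n @^-1` inner U r)) -
             fine (cond_prob nu2 (mI i) (comp_prefix w n @^-1` U))).

(** [V] is the average over the intervals of the excess [W], at a well-chosen time [n]. Its mean is
    large since the conditional laws average to [nu1] and [nu2], while its value is at most the
    proportion of intervals with a large oscillation. *)
Lemma exists_oscillation nu1 nu2 (U : set (unitI R)) (r c : R) (k : nat)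
    (I : 'I_k.+1 -> set (unitI R)) :
  mu_ergodic mu nu1 -> mu_ergodic mu nu2 -> open U -> 0 < c ->
  fine (nu2 U) + c < fine (nu1 (inner U r)) ->
  charged_intervals nu1 nu2 I ->
  exists V : seq_space (cmap R) -> R,
    [/\ measurable_fun setT V, forall w, 0 <= V w <= 1,
        (c%:E <= \int[P]_w (V w)%:E)%E &
        forall (w : seq_space (cmap R)) K, osc_bound (comp_prefix w) r K ->
          V w <= K%:R / k.+1%:R].
Proof.
move=> erg1 erg2 oU c0 gap [mI cvxI disI pos1 pos2].
have [L hL] := exists_banach_limit R.
have suppT := supp_full hP hbv.
have mi := measurable_inner U r.
have mU := open_measurable_borel oU.
pose p i n := fine (walk P (cond_prob nu1 (mI i)) n (inner U r)).
pose q i n := fine (walk P (cond_prob nu2 (mI i)) n U).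
(* Otherwise the reverse inequality holds for all [n], and applying [L] to it contradicts [gap] by
   [ergodic_limit]. *)
have [n gapn] : exists n, \sum_i q i n + c * k.+1%:R <= \sum_i p i n.
  apply: contrapT => /forallNP nogap.
  have [bp Lp] := @blim_sum L _ (index_enum 'I_k.+1) p hL (fun i => walk_bounded P _ mi).
  have [bq Lq] := @blim_sum L _ (index_enum 'I_k.+1) q hL (fun i => walk_bounded P _ mU).
  have bc : bounded_seq (fun=> c * k.+1%:R : R).
    by exists `|c * k.+1%:R|.
  have bqc : bounded_seq ((fun n => \sum_i q i n) \+ (fun=> c * k.+1%:R)).
    have [M qM] := bq; exists (M + `|c * k.+1%:R|) => n.
    by rewrite (le_trans (ler_normD _ _))// lerD.
  have : L (fun n => \sum_i p i n) <= L ((fun n => \sum_i q i n) \+ (fun=> c * k.+1%:R)).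
    apply: (blim_le hL) => // n; have /negP := nogap n.
    by rewrite -ltNge => /ltW.
  rewrite (blimD hL)// (blim_cst hL) Lp Lq.
  rewrite (eq_bigr (fun=> fine (nu1 (inner U r)))) => [|i _]; last first.
    exact: (ergodic_limit hP suppT hL (mI i) erg1 (pos1 i) mi).
  rewrite [X in _ <= X + _](eq_bigr (fun=> fine (nu2 U))) => [|i _]; last first.
    exact: (ergodic_limit hP suppT hL (mI i) erg2 (pos2 i) mU).
  rewrite !sumr_const card_ord -!(mulr_natr (fine _)) -mulrDl ler_pM2r//.
  by rewrite leNgt gap.
exists (fun w => (\sum_i W nu1 nu2 U r mI n w i) / k.+1%:R).
have mW i : measurable_fun setT (fun w => W nu1 nu2 U r mI n w i).
  apply: measurable_maxr; first exact: measurable_cst.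
  by apply: measurable_funB; apply: measurableT_comp => //;
    exact: measurable_fun_comp_prefix_preimage.
have W0 w i : 0 <= W nu1 nu2 U r mI n w i by rewrite /W le_max lexx.
have mpre (w : seq_space (cmap R)) (A : set (borel (unitI R))) : measurable A ->
    measurable (comp_prefix w n @^-1` A : set (borel (unitI R))).
  exact: measurable_comp_prefix_preimage.
have W1 w i : W nu1 nu2 U r mI n w i <= 1.
  rewrite /W ge_max ler01/= lerBlDr ler_wpDr ?fine_ge0//.
  rewrite -lee_fin fineK ?fin_num_measure//; try exact: mpre.
  by apply: probability_le1; exact: mpre.
split.
- apply: measurable_funM; last exact: measurable_cst.
  by apply: measurable_sum.
- move=> w; rewrite divr_ge0 ?sumr_ge0//= ler_pdivrMr// mul1r.
  rewrite (le_trans (ler_sum _ (fun (i : 'I_k.+1) _ => W1 w i)))//.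
  by rewrite sumr_const card_ord.
- have mW' i : measurable_fun setT (fun w => (W nu1 nu2 U r mI n w i)%:E).
    by apply/measurable_EFinP; exact: mW.
  have int_le i : ((p i n)%:E <= (q i n)%:E + \int[P]_w (W nu1 nu2 U r mI n w i)%:E)%E.
    rewrite !fineK ?fin_num_measure// !walkE -ge0_integralD//; last 2 first.
      exact: measurable_fun_comp_prefix_preimage.
      by move=> w _; rewrite lee_fin.
    apply: ge0_le_integral => //.
    - exact: measurable_fun_comp_prefix_preimage.
    - by apply: emeasurable_funD; [exact: measurable_fun_comp_prefix_preimage|exact: mW'].
    - move=> w _; have mU' := mpre w _ mU; have mi' := mpre w _ mi.
      rewrite -[leLHS]fineK ?fin_num_measure// -[X in (_ <= X + _)%E]fineK ?fin_num_measure//.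
      by rewrite -EFinD lee_fin -lerBlDl /W le_max lexx orbT.
  have -> : (\int[P]_w ((\sum_i W nu1 nu2 U r mI n w i) / k.+1%:R)%:E =
      (k.+1%:R^-1)%:E * \sum_i \int[P]_w (W nu1 nu2 U r mI n w i)%:E)%E.
    rewrite -ge0_integral_sum//; last by move=> i w _; rewrite lee_fin.
    have mS : measurable_fun setT (fun w => \sum_i (W nu1 nu2 U r mI n w i)%:E)%E.
      exact: emeasurable_sum.
    rewrite -ge0_integralZl// => [|w _]; last first.
      by apply: sume_ge0 => i _; rewrite lee_fin.
    by apply: eq_integral => w _; rewrite sumEFin -EFinM mulrC.
  rewrite muleC lee_pdivlMr// -EFinM.
  rewrite -(@leeD2lE _ (\sum_i q i n)%:E)// -EFinD.
  apply: (@le_trans _ _ (\sum_i p i n)%:E); first by rewrite lee_fin.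
  by rewrite -!sumEFin -big_split/=; apply: lee_sum => i _; exact: int_le.
- move=> w K wK; rewrite ler_pM2r ?invr_gt0//.
  (* Only these intervals contribute to the sum, each by at most 1, and [osc_bound] limits their
     number. *)
  pose bad (i : 'I_k.+1) := `[< exists x y, [/\ I i x, I i y &
    r <= `|uval (comp_prefix w n x) - uval (comp_prefix w n y)|] >].
  apply: (@le_trans _ _ (\sum_i (bad i)%:R)).
    apply: ler_sum => i _; case: (boolP (bad i)) => [_|nbad]; first exact: W1.
    rewrite /W ge_max lexx/= subr_le0.
    have mU' := mpre w _ mU; have mi' := mpre w _ mi.
    apply: fine_le; rewrite ?fin_num_measure//.
    apply: cond_prob_inner_le => // x y Ix Iy; rewrite ltNge; apply/negP => rxy.
    by move/asboolP: nbad; apply; exists x, y.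
  rewrite -natr_sum ler_nat.
  have -> : (\sum_i bad i = #|{: {i | bad i}}|)%N.
    by rewrite card_sig -sum1_card [RHS]big_mkcond; apply: eq_bigr => i _; rewrite inE; case: (bad i).
  apply: (wK n _ (fun i : {i | bad i} => I (val i))).
  - by move=> i; exact: cvxI.
  - by move=> i j x ix jx; apply: val_inj; exact: disI ix jx.
  - by move=> [i /= /asboolP].
Qed.

(* By dominated convergence: almost surely the compositions have boundedly many
   oscillations, while their expected number is at least c k. *)
Lemma ergodic_le_open nu1 nu2 (U : set (unitI R)) :
  mu_ergodic mu nu1 -> mu_ergodic mu nu2 -> open U ->
  (forall k, exists I : 'I_k.+1 -> set (unitI R), charged_intervals nu1 nu2 I) ->
  (nu1 U <= nu2 U)%E.
Proof.
move=> erg1 erg2 oU ch; rewrite leNgt; apply/negP => lt12.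
have mU := open_measurable_borel oU.
have [r r0 lt12r] := inner_approx oU lt12.
have mi := measurable_inner U r.
(* Half of the gap, to keep the inequality strict. *)
pose c := (fine (nu1 (inner U r)) - fine (nu2 U)) / 2.
have gap0 : 0 < fine (nu1 (inner U r)) - fine (nu2 U).
  by rewrite subr_gt0 fine_lt ?fin_num_measure.
have c0 : 0 < c by rewrite divr_gt0.
have gap : fine (nu2 U) + c < fine (nu1 (inner U r)).
  by rewrite -ltrBrDl ltr_pdivrMr// ltr_pMr// ltr1n.
have /choice[V Vp] k : exists V : seq_space (cmap R) -> R,
    [/\ measurable_fun setT V, forall w, 0 <= V w <= 1,
        (c%:E <= \int[P]_w (V w)%:E)%E &
        forall (w : seq_space (cmap R)) K, osc_bound (comp_prefix w) r K ->
          V w <= K%:R / k.+1%:R].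
  by have [I chI] := ch k; exact: (exists_oscillation erg1 erg2 oU c0 gap chI).
have mV k : measurable_fun setT (EFin \o V k).
  by apply/measurable_EFinP; have [] := Vp k.
(* Off a null set the bound [K] on the oscillations does not depend on [k], so [V k] is at most
   [K / k.+1]. *)
have Vae : {ae P, forall w, setT w -> (EFin \o V k) w @[k --> \oo] --> 0%E}.
  exists (~` eventually_bv mu); split.
  - by apply: measurableC; exact: measurable_eventually_bv.
  - exact: eventually_bv_full.
  apply: subsetC => w /eventually_bv_osc/(_ r r0)[K wK] _.
  apply: cvg_EFin; first exact: nearW.
  have up : K%:R / k.+1%:R @[k --> \oo] --> (0 : R).
    by rewrite -[X in _ --> X](mulr0 K%:R); apply: cvgMr; exact: cvg_harmonic.
  apply: (squeeze_cvgr _ (cvg_cst 0) up).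
  apply: nearW => k /=; have [_ /(_ w)/andP[V0 _] _ Vb] := Vp k.
  by rewrite V0 Vb.
have int1 : P.-integrable setT (cst 1%E : seq_space (cmap R) -> \bar R).
  exact: finite_measure_integrable_cst.
have dom : {ae P, forall w, forall k, setT w -> (`|(EFin \o V k) w| <= cst 1%E w)%E}.
  apply: aeW => w k _ /=; have [_ /(_ w)/andP[V0 V1] _ _] := Vp k.
  by rewrite ger0_norm// lee_fin.
have [_ _] := dominated_convergence measurableT mV (measurable_cst 0%E) Vae int1 dom.
rewrite integral0 => cv.
have : (c%:E <= 0)%E.
  rewrite -(cvg_lim _ cv)//; apply: lime_ge; first by apply/cvg_ex; eexists; exact: cv.
  by apply: nearW => k; have [] := Vp k.
by rewrite lee_fin leNgt c0.
Qed.

(** The hypotheses are symmetric, so the two measures agree on open sets, which form a generating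
    pi-system. *)
Lemma ergodic_unique nu1 nu2 :
  mu_ergodic mu nu1 -> mu_ergodic mu nu2 ->
  (forall k, exists I : 'I_k.+1 -> set (unitI R), charged_intervals nu1 nu2 I) ->
  measure_eq nu1 nu2.
Proof.
move=> erg1 erg2 ch.
have ch' k : exists I : 'I_k.+1 -> set (unitI R), charged_intervals nu2 nu1 I.
  by have [I [? ? ? ? ?]] := ch k; exists I; split.
apply: (@measure_unique _ _ (borel (unitI R)) (@open (unitI R)) (fun=> setT)) => //.
- by move=> A B oA oB; exact: openI.
- by move=> _; exact: openT.
- by rewrite bigcup_const//; exists 0%N.
- by move=> U oU; apply/eqP; rewrite eq_le !ergodic_le_open.
- by move=> _; rewrite [ltLHS](probability_setT nu1) ltry.
Qed.

End separation.

(** * Invariant measures on finite sets *)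

Section invariant_support.
Variable R : realType.
Variables (mu : probability (borel (cmap R)) R).
Hypothesis suppT : mu (supp mu) = 1%E.
Implicit Types nu q : probability (borel (unitI R)) R.

(** All maps [f] in a neighbourhood [V] of [g] send a ball around [x] into [U]. Invariance then
    bounds [nu U] below by the product of the masses of the ball and of [V], both positive. *)
Lemma supp_invariant nu (g : cmap R) (x : unitI R) :
  mu_invariant mu nu -> supp mu g -> supp nu x -> supp nu (g x).
Proof.
move=> /(step_invariantP nu suppT) inv sg sx U oU Ux.
have /nbhs_ballP[e /= e0 eU] : nbhs (g x) U by exact: open_nbhs_nbhs.
have [|d d0 gd] := @cmap_cvg R g x (e / 2); first by rewrite divr_gt0.
pose V : set (cmap R) := interior (ball g (e / 2)).
have oV : open V by exact: open_interior.
have Vg : V g by apply: nbhsx_ballx; rewrite divr_gt0.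
have W0 : (0 < nu (ball x d))%E.
  by apply: sx; [exact: unitI_ball_open|exact: ballxx].
have mU := open_measurable_borel oU; have mV := open_measurable_borel oV.
rewrite -inv// stepE.
apply: (@lt_le_trans _ _ (\int[mu]_(f in V) (cst (nu (ball x d))) f)%E).
  by rewrite integral_cst// mule_gt0//; exact: sg.
apply: (@le_trans _ _ (\int[mu]_(f in V) nu ((f : cmap R) @^-1` U))%E); last first.
  apply: ge0_subset_integral => //; exact: measurable_fun_cmap_preimage.
apply: ge0_le_integral => //.
  by apply: measurable_funTS; exact: measurable_fun_cmap_preimage.
move=> f /interior_subset gf; apply: le_measure; rewrite ?inE.
- by apply: open_measurable_borel; exact: unitI_ball_open.
- exact: measurable_cmap_preimage.
move=> y xy; apply: eU; rewrite unitI_ballE.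
rewrite [e]splitr (le_lt_trans (ler_distD (uval (g y)) _ _))// ltrD//.
  exact: gd.
exact: gf.
Qed.

Variables (P : probability (seq_space (cmap R)) R).
Hypothesis hP : is_infinite_product mu P.

Lemma walk_closed_null (K : set (unitI R)) q n :
  measurable (K : set (borel (unitI R))) ->
  (forall g : cmap R, supp mu g -> forall x, K x -> K (g x)) ->
  q (~` K) = 0%E -> walk P q n (~` K) = 0%E.
Proof.
move=> mK stab q0; have mC := measurableC mK.
elim: n => [|n IH]; first by rewrite walk0.
rewrite (walkS hP)// step_suppE//; apply: integral0_eq => g sg.
apply/eqP; rewrite eq_le measure_ge0 andbT -IH.
apply: le_measure; rewrite ?inE//; first exact: measurable_cmap_preimage.
by move=> x; apply: contra_not; exact: stab.
Qed.

(** The walk started at a point of [K] stays in [K], so its laws are dominated by the counting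
    measure [m] along a list of [K]; hence their Banach limit is an invariant probability. *)
Lemma exists_finite_invariant (K : set (unitI R)) :
  finite_set K -> K !=set0 -> closed K ->
  (forall g : cmap R, supp mu g -> forall x, K x -> K (g x)) ->
  exists nu : probability (borel (unitI R)) R,
    [/\ mu_invariant mu nu, nu K = 1%E & supp nu `<=` K].
Proof.
move=> /finite_seqP[s Ks] [p Kp] cK stab.
have mC : measurable (~` K : set (borel (unitI R))).
  by apply: open_measurable_borel; exact: closed_openC.
have mK : measurable (K : set (borel (unitI R))).
  by rewrite -[K]setCK; exact: measurableC.
have [L hL] := exists_banach_limit R.
pose m : {measure set (borel (unitI R)) -> \bar R} :=
  msum (fun i => dirac (nth p s i : borel (unitI R))) (size s).
have mE (A : set (borel (unitI R))) : m A = (\sum_(i < size s) \1_A (nth p s i))%:E.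
  by rewrite /m/= /msum -sumEFin; apply: eq_bigr => i _; rewrite /dirac.
have mT : m setT = (size s)%:R%:E.
  rewrite mE (eq_bigr (fun=> 1)) => [|i _]; last by rewrite indicE in_setT.
  by rewrite sumr_const card_ord.
have ps : p \in s by move: Kp; rewrite Ks.
have s0 : (size s)%:R != 0 :> R by rewrite pnatr_eq0; case: (s) ps.
pose nu : probability (borel (unitI R)) R := mnormalize m (dirac (p : borel (unitI R))).
have nuE A : ((size s)%:R%:E * nu A)%E = m A.
  rewrite /nu/= /mnormalize [m setT]mT/= eqe (negbTE s0)/= muleCA -EFinM.
  by rewrite mulfV// mule1.
pose q : probability (borel (unitI R)) R := dirac (p : borel (unitI R)).
have q0 n : walk P q n (~` K) = 0%E.
  apply: walk_closed_null => //.
  by rewrite /q/= diracE memNset//; apply.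
have [||nu' inv nu'E] := @exists_invariant_limit R mu P hP suppT L hL q nu (size s)%:R.
- by [].
- move=> n A mA; rewrite nuE mE.
  (* Either [A] meets [K] and [m A] is at least 1, or the walk gives no mass to [A]. *)
  have [[x [Kx Ax]]|none] := pselect (exists x, K x /\ A x).
    apply: (@le_trans _ _ 1%E); first exact: probability_le1.
    have xs : x \in s by move: Kx; rewrite Ks.
    have xi : (index x s < size s)%N by rewrite index_mem.
    rewrite lee_fin (bigD1 (Ordinal xi))//= nth_index// indicE mem_set//.
    by rewrite lerDl sumr_ge0.
  apply: (@le_trans _ _ 0%E); last by rewrite lee_fin sumr_ge0.
  rewrite -(q0 n); apply: le_measure; rewrite ?inE//.
  by move=> x Ax Kx; apply: none; exists x.
have nuC : nu' (~` K) = 0%E.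
  rewrite nu'E//; congr (_%:E); rewrite -[RHS](blim_cst hL); congr L.
  by apply/funext => n; rewrite q0.
exists nu'; split => //.
  by rewrite -[K]setCK [LHS](probability_setC nu' mC) nuC sube0.
move=> x sx; apply: contrapT => Kx.
by have := sx _ (closed_openC cK) Kx; rewrite [X in (_ < X)%E]nuC ltxx.
Qed.

End invariant_support.

(** * Finding charged intervals *)

Section charged_intervals.
Variable R : realType.
Implicit Types (nu : probability (borel (unitI R)) R) (p x y : unitI R).

Lemma open_dist_set p (U : set R) :
  open U -> open [set x | U `|uval x - uval p|].
Proof.
move=> oU; apply: (@open_comp _ _ (fun x => `|uval x - uval p|)) => // x _.
have cu : uval y @[y --> x] --> uval x := @uval_continuous R x.
exact: (cvg_norm (cvgB cu (cvg_cst (uval p)))).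
Qed.

(** Around an endpoint of the unit interval this is a single interval, see
    [order_convex_annulus]. *)
Definition annulus p (a b : R) : set (unitI R) :=
  [set x | a < `|uval x - uval p| < b].

Lemma open_annulus p a b : open (annulus p a b).
Proof.
have -> : annulus p a b = [set x | `]a, b[%classic `|uval x - uval p|].
  by apply/seteqP; split => x; rewrite /annulus /= in_itv.
by apply: open_dist_set; exact: interval_open.
Qed.

Lemma measurable_point p : measurable ([set p] : set (borel (unitI R))).
Proof.
(* The outer radius 2 exceeds the diameter, so the annulus is everything but [p]. *)
rewrite (_ : [set p] = ~` annulus p 0 2).
  by apply: measurableC; apply: open_measurable_borel; exact: open_annulus.
apply/seteqP; split => [x ->|x xp]; rewrite /annulus/=.
  by rewrite subrr normr0 ltxx.
apply: contrapT => xnp; apply: xp; rewrite /annulus/= normr_gt0 subr_eq0.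
apply/andP; split; first by apply/eqP => /uval_inj.
rewrite ltr_norml; have := uval_ge0 x; have := uval_le1 x.
by have := uval_ge0 p; have := uval_le1 p; move=> *; apply/andP; split; lra.
Qed.

(** The annuli increase to the punctured ball, which is charged because [p] lies in the support and
    is not an atom. *)
Lemma annulus_charged nu p (b : R) : supp nu p -> nu [set p] = 0%E -> 0 < b ->
  exists2 a : R, 0 < a & (0 < nu (annulus p a b))%E.
Proof.
move=> sp p0 b0.
have mA l : measurable (annulus p l.+1%:R^-1 b : set (borel (unitI R))).
  by apply: open_measurable_borel; exact: open_annulus.
have Ub : \bigcup_l annulus p l.+1%:R^-1 b = annulus p 0 b.
  apply/seteqP; split => [x [l _]|x] /andP[x0 xb].
    by rewrite /annulus/= xb andbT (le_lt_trans _ x0).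
  have [l _ le] := near_infty_natSinv_lt (PosNum x0).
  by exists l => //; rewrite /annulus/= xb andbT; exact: (le l (leqnn l)).
have cv : nu (annulus p l.+1%:R^-1 b) @[l --> \oo] --> nu (annulus p 0 b).
  rewrite -[X in _ --> nu X]Ub; apply: nondecreasing_cvg_mu => //.
    exact: bigcupT_measurable.
  move=> l l' ll'; apply/subsetPset => x /andP[lx xb]; rewrite /annulus/= xb andbT.
  by apply: le_lt_trans lx; rewrite lef_pV2 ?posrE// ler_nat ltnS.
have pos : (0 < nu (annulus p 0 b))%E.
  apply: (@lt_le_trans _ _ (nu (ball p b))).
    by apply: sp; [exact: unitI_ball_open|exact: ballxx].
  have mp := measurable_point p.
  have mA0 : measurable (annulus p 0 b : set (borel (unitI R))).
    by apply: open_measurable_borel; exact: open_annulus.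
  apply: (@le_trans _ _ (nu ([set p] `|` annulus p 0 b))).
    apply: le_measure; rewrite ?inE; [| |].
    - by apply: open_measurable_borel; exact: unitI_ball_open.
    - exact: measurableU.
    - move=> x; rewrite unitI_ballE distrC => xb.
      have [->|xp] := pselect (x = p); first by left.
      right; rewrite /annulus/= xb andbT normr_gt0 subr_eq0.
      by apply/eqP => /uval_inj.
  by rewrite (le_trans (measureU2 _ _ _))// [X in (X + _)%E]p0 add0e.
have [l al] : exists l, (0 < nu (annulus p l.+1%:R^-1 b))%E.
  apply: contrapT => /forallNP na; move: pos; rewrite ltNge => /negP; apply.
  rewrite -(cvg_lim _ cv)//; apply: lime_le; first by apply/cvg_ex; eexists; exact: cv.
  by apply: nearW => l; rewrite leNgt; apply/negP; exact: na.
by exists l.+1%:R^-1.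
Qed.

Lemma annulusS p a a' b : a' <= a -> annulus p a b `<=` annulus p a' b.
Proof.
by move=> aa x /andP[ax xb]; rewrite /annulus/= xb andbT (le_lt_trans aa).
Qed.

Lemma order_convex_annulus p a b : end01 p -> order_convex (annulus p a b).
Proof.
move=> pe x y z; rewrite /annulus/= => /andP[xa xb] /andP[za zb] /andP[xy yz].
have := uval_ge0 x; have := uval_le1 z; have := uval_ge0 y; have := uval_le1 y.
move: xa xb za zb; case: pe => ->.
  by rewrite !subr0 !ger0_norm ?uval_ge0// => *; apply/andP; split; lra.
by rewrite !ler0_norm ?subr_le0 ?uval_le1// => *; apply/andP; split; lra.
Qed.

(** Radii [b j] shrinking towards [p] are chosen recursively, each small enough for the annulus
    below the previous radius to be charged by both measures. *)
Lemma charged_near_end nu1 nu2 p (k : nat) : end01 p ->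
  supp nu1 p -> supp nu2 p -> nu1 [set p] = 0%E -> nu2 [set p] = 0%E ->
  exists I : 'I_k -> set (unitI R), charged_intervals nu1 nu2 I.
Proof.
move=> pe s1 s2 p1 p2.
have /choice[next nextP] (b : R) : exists a : R, 0 < b ->
    [/\ 0 < a, (0 < nu1 (annulus p a b))%E & (0 < nu2 (annulus p a b))%E].
  have [b0|nb] := ltP 0 b; last by exists 0.
  have [a1 a10 pos1] := annulus_charged s1 p1 b0.
  have [a2 a20 pos2] := annulus_charged s2 p2 b0.
  have m c : measurable (annulus p c b : set (borel (unitI R))).
    by apply: open_measurable_borel; exact: open_annulus.
  exists (Num.min a1 a2) => _; split; first by rewrite lt_min a10.
    apply: (lt_le_trans pos1); apply: le_measure; rewrite ?inE//.
    by apply: annulusS; rewrite ge_min lexx.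
  apply: (lt_le_trans pos2); apply: le_measure; rewrite ?inE//.
  by apply: annulusS; rewrite ge_min lexx orbT.
pose b j := iter j next 1.
have b0 j : 0 < b j by elim: j => //= j IH; have [] := nextP _ IH.
(* A charged annulus is nonempty, which forces the radii to decrease strictly. *)
have bS j : b j.+1 < b j.
  have [_ + _] := nextP _ (b0 j); rewrite ltNge => pos.
  rewrite ltNge; apply: contra pos => bb.
  rewrite (_ : annulus p _ _ = set0) ?measure0//.
  apply/seteqP; split => // x /andP[lx xl]; have := lt_trans lx xl.
  by rewrite ltNge bb.
have bD i j : (i < j)%N -> b j <= b i.+1.
  move=> ij; apply: (nonincreasing_seqP b).1 => // n; exact: ltW.
exists (fun j => annulus p (b j.+1) (b j)); split.
- by move=> i; apply: open_measurable_borel; exact: open_annulus.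
- by move=> i; exact: order_convex_annulus.
- move=> i j x /andP[xi ix] /andP[xj jx]; apply: val_inj => /=.
  case: (ltngtP i j) => // /bD ij.
    by have := lt_trans (le_lt_trans ij xi) jx; rewrite ltxx.
  by have := lt_trans (le_lt_trans ij xj) ix; rewrite ltxx.
- by move=> i; have [] := nextP _ (b0 i).
- by move=> i; have [] := nextP _ (b0 i).
Qed.

(** Small disjoint balls around [k] distinct common points of the supports are charged by both
    measures. *)
Lemma charged_infinite nu1 nu2 (k : nat) :
  infinite_set (supp nu1 `&` supp nu2) ->
  exists I : 'I_k -> set (unitI R), charged_intervals nu1 nu2 I.
Proof.
move=> /infiniteP/pcard_leP/injfunPex[/= f fK' f_inj].
have fK n : (supp nu1 `&` supp nu2) (f n) by exact: fK'.
have finj : injective f by move=> i j; apply: f_inj; rewrite inE.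
pose d (ij : 'I_k * 'I_k) := `|uval (f ij.1) - uval (f ij.2)|.
(* Half of the least mutual distance makes the balls disjoint; the default 1 keeps [r] positive when
   there are no pairs. *)
pose r := (\big[Num.min/1]_(ij | ij.1 != ij.2) d ij) / 2.
have r0 : 0 < r.
  rewrite divr_gt0//; apply: lt_bigmin => // -[i j] /= ij.
  rewrite normr_gt0 subr_eq0; apply: contra ij => /eqP/uval_inj/finj ij.
  exact/eqP/val_inj.
have rd (i j : 'I_k) : i != j -> r + r <= d (i, j).
  move=> ij; rewrite /r -splitr.
  exact: (@bigmin_le_cond _ _ _ 1 (i, j) (fun ij => ij.1 != ij.2) d ij).
exists (fun i => ball (f i) r); split.
- by move=> i; apply: open_measurable_borel; exact: unitI_ball_open.
- move=> i x y z; rewrite !unitI_ballE !ltr_norml => /andP[? ?] /andP[? ?] /andP[? ?].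
  by apply/andP; split; lra.
- move=> i j x; rewrite !unitI_ballE => ix jx; apply/eqP; apply: contraT => /rd.
  rewrite leNgt => /negP; case; rewrite /d/=.
  by rewrite (le_lt_trans (ler_distD (uval x) _ _))// ltrD// distrC.
- by move=> i; apply: (fK i).1; [exact: unitI_ball_open|exact: ballxx].
- by move=> i; apply: (fK i).2; [exact: unitI_ball_open|exact: ballxx].
Qed.

Lemma open_open01 : open (@open01 R).
Proof.
have -> : @open01 R = @uval R @^-1` `]0, 1[.
  by apply/seteqP; split => x; rewrite /open01 /= in_itv.
by apply: open_comp => [x _|]; [exact: uval_continuous|exact: interval_open].
Qed.

Lemma concentrated_end nu p : concentrated nu (@open01 R) -> end01 p ->
  nu [set p] = 0%E.
Proof.
move=> cnu pe.
have m01 := open_measurable_borel open_open01.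
have nC : nu (~` @open01 R) = 0%E.
  by rewrite [LHS](probability_setC nu m01) [X in (_ - X)%E]cnu subee.
apply/eqP; rewrite eq_le measure_ge0 andbT -[leRHS]nC.
apply: le_measure; rewrite ?inE.
- exact: measurable_point.
- exact: measurableC.
- by move=> _ ->; rewrite /open01/=; case: pe => ->; rewrite ltxx ?andbF.
Qed.

End charged_intervals.

Theorem theorem1p1 (R : realType) (mu : probability (borel (cmap R)) R)
    (P : probability (seq_space (cmap R)) R) (hP : is_infinite_product mu P)
    (hbv : (0 < P (bounded_variation_event mu))%E) :
  (forall nu1 nu2 : probability (borel (unitI R)) R,
     mu_ergodic mu nu1 -> mu_ergodic mu nu2 ->
     concentrated nu1 (@open01 R) -> concentrated nu2 (@open01 R) ->
     (@end01 R `&` supp nu1 `&` supp nu2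
        !=set0) ->
     measure_eq nu1 nu2)
  /\
  ((~ exists nu : probability (borel (unitI R)) R,
        [/\ mu_invariant mu nu, atomic nu,
            finite_set (supp nu) &
            supp nu `<=` @open01 R]) ->
   forall nu1 nu2 : probability (borel (unitI R)) R,
     mu_ergodic mu nu1 -> mu_ergodic mu nu2 ->
     concentrated nu1 (@open01 R) -> concentrated nu2 (@open01 R) ->
     ~ measure_eq nu1 nu2 ->
     supp nu1 `&` supp nu2 = set0).
Proof.
have part1 (nu1 nu2 : probability (borel (unitI R)) R) :
    mu_ergodic mu nu1 -> mu_ergodic mu nu2 ->
    concentrated nu1 (@open01 R) -> concentrated nu2 (@open01 R) ->
    (@end01 R `&` supp nu1 `&` supp nu2 !=set0) -> measure_eq nu1 nu2.
  move=> erg1 erg2 c1 c2 [p [[pe s1] s2]].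
  apply: (ergodic_unique hP hbv) => // k.
  by apply: (charged_near_end _ pe) => //; exact: concentrated_end.
split=> // noatom nu1 nu2 erg1 erg2 c1 c2 neq.
apply: contrapT => /eqP/set0P[p [s1 s2]].
have suppT := supp_full hP hbv.
set K := supp nu1 `&` supp nu2.
have [Kfin|Kinf] := pselect (finite_set K); last first.
  by apply: neq; apply: (ergodic_unique hP hbv) => // k; exact: charged_infinite.
(* An endpoint in [K] would make the measures equal by the first part. *)
have K01 : K `<=` @open01 R.
  move=> x [x1 x2]; apply: contrapT => x01; apply: neq; apply: part1 => //.
  exists x; split => //; split => //; rewrite /end01/=.
  have [x0|/eqP x0] := eqVneq (uval x) 0; [by left|right].
  apply/eqP; rewrite eq_le uval_le1 leNgt; apply/negP => xlt; apply: x01.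
  by rewrite /open01/= xlt andbT lt_neqAle uval_ge0 andbT eq_sym; apply/eqP.
have cK : closed K by apply: closedI; rewrite -openC; exact: open_setC_supp.
have stab (g : cmap R) : supp mu g -> forall x, K x -> K (g x).
  by move=> sg x [x1 x2]; split; apply: (supp_invariant suppT) => //;
    [case: erg1|case: erg2].
(* The finite set [K] carries an invariant measure inside the open interval, which [noatom]
   excludes. *)
have [nu [inv nuK sK]] :=
  exists_finite_invariant suppT hP Kfin (ex_intro _ p (conj s1 s2)) cK stab.
apply: noatom; exists nu; split => //.
- by exists K => //; exact: finite_set_countable.
- exact: sub_finite_set sK Kfin.
- exact: subset_trans sK K01.
Qed.
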